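(* For every $0<\varepsilon\le 1$ there exist $\lambda>0$ and $n_0$ such that for all $n>n_0$ and every $p\ge \lambda n^{-1/2}$ the following holds: with probability at least $1-\varepsilon$, over the choice of the random graph $G(n,p)$ and the choice of the initial state, all vertices of $V_n=\{1,\dots,n\}$ have state $\operatorname{sgn}\bigl(\sum_{v\in V_n}S_0(v)\bigr)$ after four rounds of majority dynamics, i.e. $S_4(v)=\operatorname{sgn}\bigl(\sum_{u\in V_n}S_0(u)\bigr)$ for all $v\in V_n$.
   Context: $G(n,p)$ is the binomial random graph on $V_n=\{1,\dots,n\}$ in which each pair of distinct vertices is an edge independently with probability $p$. Majority dynamics on a graph $G$: each vertex $v$ has a state $S_t(v)\in\{-1,+1\}$ at step $t\ge 0$, and $S_{t+1}(v)=\operatorname{sgn}\bigl(\sum_{u\in N(v)}S_t(u)\bigr)$ if this sum is nonzero, and $S_{t+1}(v)=S_t(v)$ otherwise, where $N(v)$ is the neighbourhood of $v$ in $G$ and $\operatorname{sgn}(x)=-1$ for $x<0$, $+1$ for $x>0$. The initial states $\{S_0(v)\}_{v\in V_n}$ are independent, each uniform on $\{-1,+1\}$, independent of the graph. *)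

(* Defs.v *)
From HB Require Import structures.
From mathcomp Require Import all_boot all_order all_algebra.
From mathcomp Require Import reals.
Set Implicit Arguments. Unset Strict Implicit. Unset Printing Implicit Defensive.
Import Order.TTheory GRing.Theory Num.Theory.
Local Open Scope ring_scope.

(* Vertex set V_n = 'I_n (i.e. {0,...,n-1}, a relabelling of {1,...,n}). *)
Definition pairs (n : nat) : {set {set 'I_n}} := [set e : {set 'I_n} | #|e| == 2%N].

Definition is_graph (n : nat) (E : {set {set 'I_n}}) : bool := E \subset pairs n.

(* Adjacency: u ~ v iff {u,v} is an edge (forces u != v for graphs). *)
Definition adj (n : nat) (E : {set {set 'I_n}}) (u v : 'I_n) : bool :=
  [set u; v] \in E.

Definition spin (b : bool) : int := if b then 1 else -1.

Definition maj_step (n : nat) (E : {set {set 'I_n}}) (s : {ffun 'I_n -> bool})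
  : {ffun 'I_n -> bool} :=
  [ffun v => let t := \sum_(u | adj E u v) spin (s u) in
             if 0 < t then true else if t < 0 then false else s v].

Definition maj_iter (n : nat) (E : {set {set 'I_n}}) (t : nat)
  (s : {ffun 'I_n -> bool}) : {ffun 'I_n -> bool} :=
  iter t (maj_step E) s.

(* Event: the initial sum is nonzero (so its sign is defined) and every vertex
   has state sgn(sum_v S_0(v)) after four rounds. *)
Definition all_agree4 (n : nat) (E : {set {set 'I_n}}) (s : {ffun 'I_n -> bool})
  : bool :=
  let m := \sum_(u : 'I_n) spin (s u) in
  (m != 0) && [forall v, maj_iter E 4 s v == (0 < m)].

Definition gnp_weight (R : realType) (n : nat) (p : R) (E : {set {set 'I_n}}) : R :=
  p ^+ #|E| * (1 - p) ^+ (#|pairs n| - #|E|).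

Definition prob_agree4 (R : realType) (n : nat) (p : R) : R :=
  \sum_(E : {set {set 'I_n}} | is_graph E)
    \sum_(s : {ffun 'I_n -> bool} | all_agree4 E s)
      gnp_weight p E * (2%:R ^- n).

(* Main.v *)
Require Import Defs.
From HB Require Import structures.
From mathcomp Require Import all_boot all_order all_algebra.
From mathcomp Require Import reals sequences exp.
From mathcomp Require Import ring lra zify.
Set Implicit Arguments. Unset Strict Implicit. Unset Printing Implicit Defensive.
Import Order.TTheory GRing.Theory Num.Theory.
Local Open Scope ring_scope.

(* The initial sum [m] satisfies [|m| >= delta sqrt n] except with probability
   [O(delta)], and by the symmetry between the two states we may fix an initial
   state with [m >= delta sqrt n]; only the graph remains random.

   Rounds 1 and 2. Fix [v] and expose its neighbourhood [N]. For [u] in [N] the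
   vote of [u] after one round has mean at least [c delta sqrt p] over the edges
   avoiding [v]. Two such votes share a single edge, so their covariance is a
   product of first-order coefficients, and Bessel's inequality bounds the
   variance of the sum of the votes over [N] by [2 |N|]. Chebyshev's inequality
   then shows that [v] is wrong after two rounds with probability
   [O(1 / (delta lambda) ^ 2)], and by Markov's inequality at most [n / 20]
   vertices are wrong.

   Round 3. A first-moment bound over all pairs of sets [S], [T] with
   [|S| <= n / 20] and [|T| >= t = floor (n p / 16)] shows that the vertices of
   [T] cannot all see a majority in [S]: there are at most [4 ^ n] pairs, while
   [n p t] is a large multiple of [n]. So fewer than [t] vertices are wrong.

   Round 4. All degrees are at least [2 t]. *)

(** * Expectation over a random set with independent elements; covariances and Bessel's
    inequality *)

Section ProductExpectation.
Variables (R : realFieldType) (p : R) (I : finType).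
Implicit Types (P Q A B E : {set I}) (f g : {set I} -> R) (e : I).

(** The ground set [P] is an argument so that edges can be exposed in stages; [P = pairs n] gives
    the law of G(n,p). *)
Definition Ex P f : R :=
  \sum_(E : {set I} | E \subset P) p ^+ #|E| * (1 - p) ^+ (#|P| - #|E|) * f E.

Lemma Ex_set0 f : Ex set0 f = f set0.
Proof.
rewrite /Ex (eq_bigl (pred1 set0)); last by move=> E; rewrite subset0.
by rewrite big_pred1_eq cards0 subnn !expr0 !mul1r.
Qed.

Lemma ExU1 e P f : e \notin P ->
  Ex (e |: P) f = p * Ex P (fun E => f (e |: E)) + (1 - p) * Ex P f.
Proof.
move=> eP; rewrite /Ex (bigID (fun E : {set I} => e \in E)) /=; congr (_ + _).
  rewrite (reindex_onto (fun E => e |: E) (fun E => E :\ e)) /=; last first.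
    by move=> E /andP[_ eE]; rewrite setD1K.
  rewrite mulr_sumr; apply: eq_big => E.
    rewrite setU11 andbT; apply/andP/idP => [[sE /eqP <-]|sE].
      by apply/subsetP => x /[!inE] /andP[nxe xE]; move/subsetP: sE => /(_ x);
        rewrite !inE (negPf nxe) orbC orbF in xE *; apply; rewrite ?xE ?orbT.
    have eE : e \notin E by apply: contra eP => /(subsetP sE).
    by rewrite setUS // setU1K.
  move=> /andP[/andP[sE _] /eqP EE].
  have eE : e \notin E by rewrite -EE !inE eqxx.
  by rewrite !cardsU1 eE eP /= !add1n exprS subSS !mulrA.
rewrite mulr_sumr; apply: eq_big => E.
  apply/andP/idP => [[sE eE]|sE].
    apply/subsetP => x xE; move/subsetP: sE => /(_ x xE).
    by rewrite !inE => /orP[/eqP xe|//]; rewrite -xe xE in eE.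
  split; first by apply: subset_trans sE (subsetUr _ _).
  by apply: contra eP => /(subsetP sE).
move=> /andP[sE eE]; have sEP : E \subset P.
  apply/subsetP => x xE; move/subsetP: sE => /(_ x xE).
  by rewrite !inE => /orP[/eqP xe|//]; rewrite -xe xE in eE.
rewrite cardsU1 eP /= add1n subSn ?subset_leq_card // exprS.
by rewrite !mulrA (mulrC (p ^+ _)).
Qed.

Lemma eq_Ex P f g : (forall E, E \subset P -> f E = g E) -> Ex P f = Ex P g.
Proof. by move=> fg; apply: eq_bigr => E /fg ->. Qed.

Lemma ExD P f g : Ex P (fun E => f E + g E) = Ex P f + Ex P g.
Proof. by rewrite /Ex -big_split /=; apply: eq_bigr => E _; rewrite mulrDr. Qed.

Lemma ExZ P c f : Ex P (fun E => c * f E) = c * Ex P f.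
Proof. by rewrite /Ex mulr_sumr; apply: eq_bigr => E _; rewrite mulrCA. Qed.

Lemma ExB P f g : Ex P (fun E => f E - g E) = Ex P f - Ex P g.
Proof.
rewrite -[- Ex P g]mulN1r -ExZ -ExD.
by apply: eq_Ex => E _; rewrite mulN1r.
Qed.

Lemma Ex_sum (J : finType) (K : pred J) P (F : J -> {set I} -> R) :
  Ex P (fun E => \sum_(j | K j) F j E) = \sum_(j | K j) Ex P (F j).
Proof.
rewrite /Ex exchange_big /=; apply: eq_bigr => E _.
by rewrite mulr_sumr.
Qed.

Lemma set_card_ind (K : {set I} -> Prop) :
  K set0 -> (forall e P, e \notin P -> K P -> K (e |: P)) -> forall P, K P.
Proof.
move=> K0 KU P; have [k] := ubnP #|P|; elim: k P => // k IH P.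
have [->//|/set0Pn[e eP]] := eqVneq P set0.
rewrite -(setD1K eP) cardsU1 !inE eqxx /= add1n ltnS => lt.
by apply: KU; [rewrite !inE eqxx | apply: IH].
Qed.

Lemma Ex_cst P c : Ex P (fun=> c) = c.
Proof.
elim/set_card_ind: P => [|e P eP IH]; first by rewrite Ex_set0.
by rewrite ExU1 // IH; ring.
Qed.

Lemma ExU P Q f : [disjoint P & Q] ->
  Ex (P :|: Q) f = Ex P (fun E1 => Ex Q (fun E2 => f (E1 :|: E2))).
Proof.
elim/set_card_ind: P f => [|e P eP IH] f dPQ.
  by rewrite set0U Ex_set0; apply: eq_Ex => E _; rewrite set0U.
have eQ : e \notin Q by rewrite (disjointFr dPQ) ?setU11.
have {}dPQ : [disjoint P & Q] by apply: disjointWl dPQ; exact: subsetUr.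
rewrite -setUA ExU1 ?inE ?negb_or ?eP // ExU1 // !IH //.
congr (_ * _ + _); apply: eq_Ex => E1 _; apply: eq_Ex => E2 _.
by rewrite setUA.
Qed.

(** Two-stage exposure: the elements inside [A] are revealed first. *)
Lemma ExID A P f : Ex P f =
  Ex (P :&: A) (fun E1 => Ex (P :\: A) (fun E2 => f (E1 :|: E2))).
Proof.
rewrite -{1}(setID P A) ExU // -setI_eq0; apply/eqP/setP => x.
by rewrite !inE; case: (x \in A); rewrite /= ?andbF.
Qed.

Lemma Ex_local A P f : (forall E, f E = f (E :&: A)) -> Ex P f = Ex (P :&: A) f.
Proof.
move=> fA; rewrite (ExID A); apply: eq_Ex => E1 s1.
rewrite -[RHS](Ex_cst (P :\: A)); apply: eq_Ex => E2 s2.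
rewrite fA [RHS]fA setIUl (_ : E2 :&: A = set0) ?setU0 //.
apply/eqP; rewrite setI_eq0; apply: disjointWl s2 _.
rewrite -setI_eq0; apply/eqP/setP => x; rewrite !inE.
by case: (x \in A); rewrite ?andbF.
Qed.

Lemma Ex_prod P (W : I -> R) :
  Ex P (fun E => \prod_(e in E) W e) = \prod_(e in P) (1 - p + p * W e).
Proof.
elim/set_card_ind: P => [|e P eP IH]; first by rewrite Ex_set0 !big_set0.
rewrite ExU1 // big_setU1 //= -IH.
rewrite (@eq_Ex _ _ (fun E => W e * \prod_(e' in E) W e')) => [|E sE].
  by rewrite ExZ; ring.
by rewrite big_setU1 //; apply: contra eP => /(subsetP sE).
Qed.

(** Once [E :&: A] is exposed, [f] is constant, and the remaining elements still average [g] to its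
    full mean. *)
Lemma Ex_indep A B P f g :
  (forall E, f E = f (E :&: A)) -> (forall E, g E = g (E :&: B)) ->
  P :&: A :&: B = set0 -> Ex P (fun E => f E * g E) = Ex P f * Ex P g.
Proof.
move=> fA gB AB0; have dis0 (C : {set I}) : C \subset P :&: A -> C :&: B = set0.
  by move=> s; apply/eqP; rewrite -subset0 -AB0 setSI.
have disA (C : {set I}) : C \subset P :\: A -> C :&: A = set0.
  move=> s; apply/eqP; rewrite -subset0; apply/subsetP => x.
  by rewrite inE => /andP[/(subsetP s)]; rewrite inE => /andP[/negPf->].
have EgP : Ex P g = Ex (P :\: A) g.
  rewrite (ExID A) -[RHS](Ex_cst (P :&: A)); apply: eq_Ex => E1 s1.
  apply: eq_Ex => E2 _; rewrite gB [RHS]gB setIUl (dis0 E1) ?set0U //.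
rewrite EgP (Ex_local _ fA) (ExID A) mulrC -ExZ; apply: eq_Ex => E1 s1.
rewrite mulrC -ExZ; apply: eq_Ex => E2 s2; congr (_ * _).
  by rewrite fA [RHS]fA setIUl (disA E2) ?setU0.
by rewrite gB [RHS]gB setIUl (dis0 E1) ?set0U.
Qed.

Hypothesis p01 : 0 <= p <= 1.

Lemma le_Ex P f g : (forall E, E \subset P -> f E <= g E) -> Ex P f <= Ex P g.
Proof.
move=> fg; apply: ler_sum => E /fg; apply: ler_wpM2l.
by case/andP: p01 => p0 p1; rewrite mulr_ge0 ?exprn_ge0 ?subr_ge0.
Qed.

Lemma Ex_ge0 P f : (forall E, E \subset P -> 0 <= f E) -> 0 <= Ex P f.
Proof. by move=> f0; rewrite -(Ex_cst P 0); apply: le_Ex. Qed.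

(* The discrete derivative, i.e. the coefficient of [(e \in E) - p] in the
   orthogonal expansion of [f]. *)
Definition Dx P e f := Ex (P :\ e) (fun E => f (e |: E) - f E).

Let chi e E : R := (e \in E)%:R - p.

Lemma Ex_mul_chi P e f : e \in P ->
  Ex P (fun E => f E * chi e E) = p * (1 - p) * Dx P e f.
Proof.
move=> eP; rewrite -{1}(setD1K eP) ExU1 ?inE ?eqxx //.
rewrite /Dx ExB mulrBr; have -> : Ex (P :\ e) (fun E => f E * chi e E) =
   - p * Ex (P :\ e) f.
  rewrite -ExZ; apply: eq_Ex => E sE; rewrite /chi.
  have -> : (e \in E) = false.
    by apply/negP => /(subsetP sE); rewrite !inE eqxx.
  by rewrite sub0r mulrC.
have -> : Ex (P :\ e) (fun E => f (e |: E) * chi e (e |: E)) =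
   (1 - p) * Ex (P :\ e) (fun E => f (e |: E)).
  by rewrite -ExZ; apply: eq_Ex => E sE; rewrite /chi setU11 mulrC.
ring.
Qed.

Lemma Ex_chi_chi P e e' : e \in P ->
  Ex P (fun E => chi e' E * chi e E) = p * (1 - p) * (e == e')%:R.
Proof.
move=> eP; rewrite Ex_mul_chi //; congr (_ * _).
rewrite -[RHS](Ex_cst (P :\ e)); apply: eq_Ex => E sE; rewrite /chi !inE.
have [->|] := eqVneq e' e; last by move=> _ /=; ring.
rewrite /=; have -> : (e \in E) = false.
  by apply/negP => /(subsetP sE); rewrite !inE eqxx.
by rewrite /=; ring.
Qed.

(** [L] is the first-order part of [f] along the orthogonal centred indicators [chi e]. The means of
    [f * L] and [L ^ 2] agree, and the bound is the nonnegativity of the mean of [(f - L) ^ 2]. *)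
Lemma bessel P Q f : Q \subset P ->
  \sum_(e in Q) p * (1 - p) * Dx P e f ^+ 2 <= Ex P (fun E => f E ^+ 2).
Proof.
move=> sQ; pose L E := \sum_(e in Q) Dx P e f * chi e E.
have EfL : Ex P (fun E => f E * L E) = \sum_(e in Q) p * (1 - p) * Dx P e f ^+ 2.
  transitivity (Ex P (fun E => \sum_(e in Q) Dx P e f * (f E * chi e E))).
    by apply: eq_Ex => E _; rewrite mulr_sumr; apply: eq_bigr => e _; ring.
  rewrite Ex_sum; apply: eq_bigr => e eQ.
  by rewrite ExZ Ex_mul_chi ?(subsetP sQ) //; ring.
have ELL : Ex P (fun E => L E ^+ 2) = \sum_(e in Q) p * (1 - p) * Dx P e f ^+ 2.
  transitivity (Ex P (fun E => \sum_(e in Q) Dx P e f * (\sum_(e' in Q)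
      Dx P e' f * (chi e' E * chi e E)))).
    apply: eq_Ex => E _; rewrite expr2 {1}/L mulr_suml; apply: eq_bigr => e _.
    by rewrite -mulrA /L mulr_sumr; congr (_ * _); apply: eq_bigr => e' _; ring.
  rewrite Ex_sum; apply: eq_bigr => e eQ; rewrite ExZ Ex_sum.
  rewrite (bigD1 e) //= big1 => [|e' /andP[_ /negPf ne]].
    by rewrite ExZ Ex_chi_chi ?(subsetP sQ) // eqxx /=; ring.
  by rewrite ExZ Ex_chi_chi ?(subsetP sQ) // eq_sym ne /=; ring.
have : 0 <= Ex P (fun E => f E ^+ 2 - 2 * (f E * L E) + L E ^+ 2).
  apply: Ex_ge0 => E _; rewrite (_ : _ + _ = (f E - L E) ^+ 2); last by ring.
  exact: sqr_ge0.
rewrite ExD ExB ExZ EfL ELL; lra.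
Qed.

(** Given whether [e] is present, [f] and [g] are independent, so the covariance is that of their
    conditional means, two functions of one Bernoulli variable. *)
Lemma Ex_cov A B P e f g : e \in P ->
  (forall E, f E = f (E :&: A)) -> (forall E, g E = g (E :&: B)) ->
  P :&: A :&: B \subset [set e] ->
  Ex P (fun E => f E * g E) - Ex P f * Ex P g
    = p * (1 - p) * Dx P e f * Dx P e g.
Proof.
move=> eP fA gB AB.
have [f1A g1B] : (forall E, f (e |: E) = f (e |: (E :&: A))) /\
                 (forall E, g (e |: E) = g (e |: (E :&: B))).
  split=> E; [rewrite fA [RHS]fA | rewrite gB [RHS]gB];
    by congr (_ _); apply/setP => x; rewrite !inE;
       case: (x \in E); case: (x == e); case: (x \in _).
have dis : (P :\ e) :&: A :&: B = set0.
  apply/eqP; rewrite -subset0; apply/subsetP => x; rewrite !inE -!andbA.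
  case/and4P => xe xP xA xB; have := subsetP AB x.
  by rewrite !inE xP xA xB (negPf xe) => /(_ isT).
rewrite -{1 2 3}(setD1K eP) !ExU1 ?inE ?eqxx //.
rewrite (Ex_indep fA gB dis).
rewrite (@Ex_indep A B _ (fun E => f (e |: E)) (fun E => g (e |: E))) //.
rewrite /Dx !ExB; ring.
Qed.

(** The event forces a deviation from the mean by at least the mean itself. *)
Lemma chebyshev_le0 P f : 0 < Ex P f ->
  Ex P (fun E => (f E <= 0)%R%:R) <=
  (Ex P (fun E => f E ^+ 2) - Ex P f ^+ 2) / Ex P f ^+ 2.
Proof.
set m := Ex P f => m0.
have -> : Ex P (fun E => f E ^+ 2) - m ^+ 2 = Ex P (fun E => (f E - m) ^+ 2).
  transitivity (Ex P (fun E => f E ^+ 2 - 2 * m * f E + m ^+ 2)); last first.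
    by apply: eq_Ex => E _; ring.
  by rewrite ExD ExB ExZ Ex_cst -/m; ring.
rewrite mulrC -ExZ; apply: le_Ex => E _.
case: (lerP (f E) 0) => [f0|_]; last by rewrite mulr_ge0 ?invr_ge0 ?sqr_ge0.
clearbody m; rewrite mulrC ler_pdivlMr ?exprn_gt0 // mul1r; nra.
Qed.

End ProductExpectation.

(** * The binomial distribution *)

Section BinomialExpectation.
Variables (R : realFieldType) (p : R).

(** Recursion on the trials, rather than a sum with binomial coefficients, makes each identity a
    short induction; [Ex_card] identifies it with the law of [#|E|]. *)
Fixpoint Eb (N : nat) (f : nat -> R) : R :=
  if N is N'.+1 then p * Eb N' (fun k => f k.+1) + (1 - p) * Eb N' f else f 0%N.

Lemma eq_Eb N f g : f =1 g -> Eb N f = Eb N g.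
Proof.
elim: N f g => [|N IH] f g fg /=; first exact: fg.
by rewrite (IH _ (fun k => g k.+1)) ?(IH f g).
Qed.

Lemma Ex_card (I : finType) (P : {set I}) f :
  Ex p P (fun E => f #|E|) = Eb #|P| f.
Proof.
elim/set_card_ind: P f => [|e P eP IH] f; first by rewrite Ex_set0 cards0.
rewrite ExU1 // cardsU1 eP add1n /= -!IH; congr (_ * _ + _).
apply: eq_Ex => E sE; rewrite cardsU1.
by rewrite (_ : e \notin E) //; apply: contra eP => /(subsetP sE).
Qed.

Lemma EbD N f g : Eb N (fun k => f k + g k) = Eb N f + Eb N g.
Proof. by elim: N f g => //= N IH f g; rewrite !IH; ring. Qed.

Lemma EbZ N c f : Eb N (fun k => c * f k) = c * Eb N f.
Proof. by elim: N f => //= N IH f; rewrite !IH; ring. Qed.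

Lemma Eb_cst N c : Eb N (fun=> c) = c.
Proof. by elim: N => //= N ->; ring. Qed.

Lemma Eb_sum N (J : finType) (K : pred J) (F : J -> nat -> R) :
  Eb N (fun k => \sum_(j | K j) F j k) = \sum_(j | K j) Eb N (F j).
Proof. by elim: N F => //= N IH F; rewrite !IH !mulr_sumr -big_split. Qed.

Lemma Eb_exchange N M (f : nat -> nat -> R) :
  Eb N (fun i => Eb M (f i)) = Eb M (fun j => Eb N (fun i => f i j)).
Proof.
elim: N f => //= N IH f; rewrite !IH -!EbZ -EbD; apply: eq_Eb => k.
by [].
Qed.

Lemma Eb_add N M f : Eb (N + M) f = Eb N (fun i => Eb M (fun y => f (i + y)%N)).
Proof. by elim: N f => //= N IH f; rewrite !IH. Qed.

Lemma Eb_geom N x : Eb N (fun k => x ^+ k) = (1 - p + p * x) ^+ N.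
Proof.
elim: N => [|N IH] /=; first by rewrite !expr0.
rewrite (@eq_Eb _ (fun k => x ^+ k.+1) (fun k => x * x ^+ k)); last first.
  by move=> k; rewrite exprS.
by rewrite EbZ IH exprS; ring.
Qed.

Lemma Eb_mean N : Eb N (fun k => k%:R) = N%:R * p.
Proof.
elim: N => [|N IH] /=; first by rewrite mul0r.
rewrite (@eq_Eb _ (fun k => k.+1%:R) (fun k => k%:R + 1)); last first.
  by move=> k; rewrite -natr1.
by rewrite EbD Eb_cst IH -natr1; ring.
Qed.

Lemma Eb_var N : Eb N (fun k => (k%:R - N%:R * p) ^+ 2) = N%:R * p * (1 - p).
Proof.
suff H : Eb N (fun k => k%:R ^+ 2) = N%:R * p * (1 - p) + (N%:R * p) ^+ 2.
  rewrite (@eq_Eb _ _ (fun k => k%:R ^+ 2 + (- 2 * (N%:R * p) * k%:R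
    + (N%:R * p) ^+ 2))); last by move=> k; ring.
  by rewrite !EbD EbZ Eb_cst Eb_mean H; ring.
elim: N => [|N IH] /=; first by rewrite !mul0r expr0n addr0.
rewrite (@eq_Eb _ (fun k => k.+1%:R ^+ 2) (fun k => k%:R^+2 + (2 * k%:R + 1)));
  last by move=> k; rewrite -natr1; ring.
by rewrite !EbD EbZ Eb_cst Eb_mean IH -natr1; ring.
Qed.

Hypothesis p01 : 0 <= p <= 1.

Lemma le_Eb N f g : (forall k, f k <= g k) -> Eb N f <= Eb N g.
Proof.
case/andP: p01 => p0 p1; elim: N f g => [|N IH] f g fg /=; first exact: fg.
by rewrite lerD ?ler_wpM2l ?subr_ge0 ?IH.
Qed.

Lemma Eb_chebyshev N (t : R) (Z : pred nat) : 0 < t ->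
  (forall k, Z k -> t <= `|k%:R - N%:R * p|) ->
  Eb N (fun k => (Z k)%:R) <= N%:R * p / t ^+ 2.
Proof.
move=> t0 Zt; apply: (@le_trans _ _ (N%:R * p * (1 - p) / t ^+ 2)).
  rewrite -Eb_var mulrC -EbZ; apply: le_Eb => k.
  case Zk: (Z k); last by rewrite mulr_ge0 ?invr_ge0 ?sqr_ge0.
  rewrite mulrC ler_pdivlMr ?exprn_gt0 // mul1r -[(_ - _) ^+ 2]real_normK ?num_real //.
  by rewrite ler_pXn2r ?nnegrE ?normr_ge0 ?Zt // ltW.
case/andP: p01 => p0 p1; apply: ler_wpM2r; first by rewrite invr_ge0 sqr_ge0.
have /mulr_ge0 : 0 <= N%:R * p :> R by rewrite mulr_ge0.
move=> /(_ _ p0); nra.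
Qed.

End BinomialExpectation.

(** * A lower bound for the mean of one vote *)

Section Bias.
Variables (R : realType) (p : R).
Hypothesis p01 : 0 <= p <= 1.

(* Pigeonhole: the typical range of the binomial is covered by [M] blocks of
   length [l], and two independent copies share a block with probability
   [\sum_c q_c ^ 2 >= (\sum_c q_c) ^ 2 / M]. *)
Lemma Eb_collision (N w l : nat) : (0 < l)%N -> (0 < w)%N ->
  2 * (N%:R * p) <= w%:R ^+ 2 ->
  (4 * ((2 * w) %/ l).+1%:R)^-1 <=
  Eb p N (fun i => Eb p N (fun j => ((i < j + l) && (j < i + l))%N%:R)).
Proof.
move=> l0 w0 Nw; set M := ((2 * w) %/ l).+1.
have Np0 : 0 <= N%:R * p by case/andP: p01 => ? _; rewrite mulr_ge0.
pose c0 := Num.truncn (N%:R * p).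
have /andP[c0l c0u] : c0%:R <= N%:R * p < c0.+1%:R by exact: truncn_itv.
have w0R : 0 < w%:R :> R by rewrite ltr0n.
pose win (i : nat) := `|i%:R - N%:R * p| < w%:R.
(* Blocks are counted from the left end of the window; truncated subtraction starts them at 0 when
   [c0 < w]. *)
pose cl i := ((i - (c0 - w)) %/ l)%N.
have winP i : win i -> (c0 - w <= i)%N /\ (i - (c0 - w) <= 2 * w)%N.
  rewrite /win ltr_norml => /andP[h1 h2].
  have : (c0 < i + w)%N by rewrite -(ltr_nat R) natrD; lra.
  have : (i < c0.+1 + w)%N by rewrite -(ltr_nat R) natrD; lra.
  lia.
pose a (c : 'I_M) (i : nat) : R := (win i && (cl i == c))%:R.
pose q c := Eb p N (a c).
(* By Chebyshev's inequality, [2 N p <= w ^ 2] keeps at least half of the mass in the window. *)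
have sumq : 1 / 2 <= \sum_c q c.
  have E1 : \sum_c q c = Eb p N (fun i => (win i)%:R).
    rewrite -Eb_sum; apply: eq_Eb => i; rewrite /a.
    case wi: (win i); last by rewrite big1.
    have cM : (cl i < M)%N by rewrite ltnS leq_div2r //; case: (winP i wi).
    rewrite (bigD1 (Ordinal cM)) //= eqxx big1 ?addr0 // => c /eqP nc.
    by case: eqP => // e; case: nc; apply: val_inj.
  have E2 : Eb p N (fun i => (~~ win i)%:R) <= 1 / 2.
    apply: le_trans (@Eb_chebyshev _ _ p01 N _ (fun i => ~~ win i) w0R _) _.
      by move=> k; rewrite /win -leNgt.
    by rewrite ler_pdivrMr ?exprn_gt0 //; lra.
  have E3 : Eb p N (fun i => (win i)%:R) + Eb p N (fun i => (~~ win i)%:R) = 1.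
    rewrite -EbD -[RHS](Eb_cst p N); apply: eq_Eb => i.
    by case: (win i); rewrite /= ?addr0 ?add0r.
  by rewrite E1; lra.
apply: (@le_trans _ _ (\sum_c q c ^+ 2)); last first.
  have -> : \sum_c q c ^+ 2 =
      Eb p N (fun i => Eb p N (fun j => \sum_c a c i * a c j)).
    transitivity (Eb p N (fun i => \sum_c q c * a c i)).
      rewrite Eb_sum; apply: eq_bigr => c _; by rewrite EbZ expr2.
    apply: eq_Eb => i; rewrite Eb_sum; apply: eq_bigr => c _.
    by rewrite EbZ mulrC.
  (* At most one block contains both [i] and [j], and then they differ by less than [l]. *)
  apply: le_Eb => // i; apply: le_Eb => // j.
  have [nr|nr] := boolP ((i < j + l) && (j < i + l))%N.
    have [cM|cM] := ltnP (cl i) M; last first.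
      rewrite big1 // => c _; rewrite /a; case: (cl i =P c) => [e|].
        by move: cM; rewrite e leqNgt ltn_ord.
      by rewrite andbF mul0r.
    rewrite (bigD1 (Ordinal cM)) //= big1 ?addr0 => [|c /eqP nc].
      by rewrite /a; case: (_ && _); case: (_ && _); rewrite /= ?mulr0 ?mul0r ?mulr1.
    rewrite /a; case: (cl i =P c) => [e|]; last by rewrite andbF mul0r.
    by case: nc; apply: val_inj.
  rewrite big1 // => c _; rewrite /a.
  case wi: (win i); last by rewrite mul0r.
  case wj: (win j); last by rewrite mulr0.
  case: eqP => [ei|]; last by rewrite mul0r.
  case: eqP => [ej|]; last by rewrite mulr0.
  case/negP: nr; case: (winP _ wi) => bi _; case: (winP _ wj) => bj _.
  have := divn_eq (i - (c0 - w)) l; have := divn_eq (j - (c0 - w)) l.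
  have := ltn_pmod (i - (c0 - w)) l0; have := ltn_pmod (j - (c0 - w)) l0.
  rewrite /cl in ei ej; rewrite ei ej; lia.
have M0 : 0 < M%:R :> R by rewrite ltr0n.
(* Cauchy-Schwarz in tangent form, [q ^ 2 >= 2 th q - th ^ 2], where [th] is the block average of a
   total mass 1/2. *)
pose th : R := (2 * M%:R)^-1.
have thM : M%:R * th = 1 / 2 by rewrite /th; field; rewrite gt_eqF.
apply: (@le_trans _ _ (\sum_c (2 * th * q c - th ^+ 2))); last first.
  by apply: ler_sum => c _; have := sqr_ge0 (q c - th); nra.
rewrite sumrB -mulr_sumr sumr_const card_ord -[th ^+ 2 *+ M]mulr_natl.
have -> : (4 * M%:R)^-1 = th / 2 by rewrite /th; field; rewrite gt_eqF.
have th0 : 0 < th by rewrite invr_gt0; lra.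
have : 2 * th * (1 / 2) <= 2 * th * \sum_c q c by apply: ler_wpM2l => //; lra.
have -> : M%:R * th ^+ 2 = th / 2 by rewrite expr2 mulrA thM; ring.
by lra.
Qed.

Definition sgb (b : bool) : R := if b then 1 else -1.

(* Exchanging [i] and [j] pairs the outcomes so that the average of the two
   signs is [+1] when [|i - j| <= l - 2] and [l <= y], and never negative
   unless [|i - j| <= 1] and [y <= 1]. *)
Lemma Eb_bias (b d l w : nat) : (2 < l)%N -> (0 < w)%N ->
  16 <= d%:R * p -> 2 * l%:R <= d%:R * p -> 2 * (b%:R * p) <= w%:R ^+ 2 ->
  (8 * ((2 * w) %/ l.-1).+1%:R)^-1 <=
  Eb p b (fun i => Eb p b (fun j => Eb p d (fun y => sgb (j + 2 <= i + y)%N))).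
Proof.
move=> l3 w0 d16 ld bw; set F := fun i j y => sgb (j + 2 <= i + y)%N.
pose nr i j : R := ((i < j + l.-1) && (j < i + l.-1))%N%:R.
set X := Eb p b _.
have X2 : X = 1 / 2 * Eb p b (fun i => Eb p b (fun j => Eb p d (fun y =>
     F i j y + F j i y))).
  have -> : Eb p b (fun i => Eb p b (fun j => Eb p d (fun y =>
     F i j y + F j i y))) = X + Eb p b (fun i => Eb p b (fun j =>
       Eb p d (fun y => F j i y))).
    rewrite -EbD; apply: eq_Eb => i; rewrite -EbD; apply: eq_Eb => j.
    by rewrite EbD.
  by rewrite [X in _ + X]Eb_exchange -/X; field.
(* [l] is at most half the mean of [y], so Chebyshev's bound is [4 / (d p) <= 1 / 4]. *)
have PY : Eb p d (fun y => (y < l)%N%:R) <= 1 / 4.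
  have t0 : 0 < d%:R * p / 2 by lra.
  apply: le_trans (@Eb_chebyshev _ _ p01 d _ (fun y => y < l)%N t0 _) _.
    move=> k; rewrite -(ltr_nat R) => kl; rewrite ler0_norm; lra.
  rewrite ler_pdivrMr ?exprn_gt0 // ; nra.
have nr0 i j : 0 <= nr i j by rewrite ler0n.
apply: (@le_trans _ _ (Eb p b (fun i => Eb p b (fun j => 1 / 2 * nr i j)))).
  apply: le_trans (_ : 1 / 2 * Eb p b (fun i => Eb p b (nr i)) <= _); last first.
    by rewrite -EbZ; apply: le_Eb => // i; rewrite -EbZ.
  have l0 : (0 < l.-1)%N by lia.
  have := Eb_collision l0 w0 bw; rewrite -/nr.
  have : 0 < ((2 * w) %/ l.-1).+1%:R :> R by rewrite ltr0n.
  move: (_.+1%:R) => K K0.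
  have -> : (8 * K)^-1 = 1 / 2 * (4 * K)^-1 by field; rewrite gt_eqF.
  by apply: ler_wpM2l; lra.
rewrite X2 -EbZ; apply: le_Eb => // i; rewrite -EbZ; apply: le_Eb => // j.
rewrite -EbZ.
(* The paired average is at least [nr] if [l <= y] and at least [- nr] otherwise; since [y < l] has
   probability at most 1/4, half of [nr] remains. *)
apply: (@le_trans _ _ (Eb p d (fun y => nr i j + (-2 * nr i j) * (y < l)%N%:R))).
  rewrite EbD Eb_cst EbZ; have := nr0 i j; nra.
apply: le_Eb => // y; rewrite /F /nr /sgb.
have [h1|h1] := leqP (j + 2) (i + y); have [h2|h2] := leqP (i + 2) (j + y);
 have [h3|h3] := ltnP y l; have [h4|h4] := boolP (_ && _);
 rewrite /= ?mulr0 ?mulr1; try lra; exfalso; lia.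
Qed.

End Bias.

(** * Edges at a vertex, neighbourhoods and small degrees *)

Section Edges.
Variable n : nat.
Implicit Types (u v w : 'I_n) (E : {set {set 'I_n}}).

Definition incident v : {set {set 'I_n}} := [set e : {set 'I_n} | v \in e].

Definition nbrs E v : {set 'I_n} := [set u | adj E u v].

Lemma pairs_set2 u v : ([set u; v] \in pairs n) = (u != v).
Proof. by rewrite in_set cards2 eqSS eqb1. Qed.

Lemma pair_eq u v (e : {set 'I_n}) : e \in pairs n -> u \in e -> v \in e -> u != v ->
  e = [set u; v].
Proof.
rewrite inE => /eqP e2 ue ve uv; apply/eqP; rewrite eq_sym eqEcard cards2 uv e2.
by rewrite andbT; apply/subsetP => x /[!inE] /orP[] /eqP->.
Qed.

Lemma set2_injl u w w' : w != u -> [set w; u] = [set w'; u] -> w = w'.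
Proof.
move=> wu e; have : w \in [set w'; u] by rewrite -e !inE eqxx.
by rewrite !inE (negPf wu) orbF => /eqP.
Qed.

Lemma set2_inj_in u (W : {set 'I_n}) : u \notin W ->
  {in W &, injective (fun w => [set w; u])}.
Proof.
by move=> uW w w' wW _; apply: set2_injl; apply: contraNneq uW => <-.
Qed.

Lemma adj_irr E u : E \subset pairs n -> ~~ adj E u u.
Proof. by move=> sE; apply/negP => /(subsetP sE); rewrite pairs_set2 eqxx. Qed.

(** All edges of [E] join [u] to [W], so an edge and its end in [W] determine each other. *)
Lemma card_nbrs_star (W : {set 'I_n}) u E : u \notin W ->
  E \subset [set [set w; u] | w in W] -> #|nbrs E u| = #|E|.
Proof.
move=> uW sE; have sN : nbrs E u \subset W.
  apply/subsetP => w; rewrite inE => wu; case/imsetP: (subsetP sE _ wu) => x xW.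
  move=> e; have : x \in [set w; u] by rewrite e !inE eqxx.
  rewrite !inE => /orP[/eqP <-//|/eqP xu]; by rewrite -xu xW in uW.
have EE : E = [set [set w; u] | w in nbrs E u].
  apply/setP => e; apply/idP/imsetP => [eE|[w wN ->]]; last by rewrite inE in wN.
  case/imsetP: (subsetP sE _ eE) => x xW ex; exists x => //.
  by rewrite inE /adj -ex.
rewrite [in RHS]EE card_in_imset // => w w' /(subsetP sN) h /(subsetP sN) h'.
exact: (set2_inj_in uW).
Qed.

Lemma pairs_incident u :
  pairs n :&: incident u = [set [set w; u] | w in [set~ u]].
Proof.
apply/setP => e; rewrite inE; apply/andP/imsetP => [[eP]|[w]].
  rewrite inE => ue; have /card_gt0P[w] : (0 < #|e :\ u|)%N.
    by move: eP; rewrite inE (cardsD1 u) ue add1n eqSS => /eqP->.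
  rewrite !inE => /andP[wu we]; exists w; first by rewrite !inE.
  exact: pair_eq.
by rewrite !inE => wu ->; rewrite cards2 wu !inE eqxx orbT.
Qed.

Lemma card_incident u : #|pairs n :&: incident u| = n.-1.
Proof.
rewrite pairs_incident card_in_imset; last first.
  by apply: set2_inj_in; rewrite !inE eqxx.
by rewrite cardsC1 card_ord.
Qed.

Lemma card_nbrs u E : E \subset pairs n -> #|nbrs E u| = #|E :&: incident u|.
Proof.
move=> sE; transitivity #|nbrs (E :&: incident u) u|.
  by congr #|pred_of_set _|; apply/setP => w; rewrite !inE /adj !inE eqxx orbT andbT.
apply: (@card_nbrs_star [set~ u]); first by rewrite !inE eqxx.
by rewrite -pairs_incident; apply: setSI.
Qed.

Variables (R : realType) (p : R).
Hypothesis p01 : 0 <= p <= 1.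

(** Markov's inequality for [2 ^ (- degree)], whose mean is [(1 - p / 2) ^ (n - 1)]. *)
Lemma prob_small_degree v k :
  Ex p (pairs n) (fun E => (#|nbrs E v| < k)%N%:R) <= 2 ^+ k * (1 - p / 2) ^+ n.-1.
Proof.
have -> : (1 - p / 2) ^+ n.-1 =
   Ex p (pairs n) (fun E => 2^-1 ^+ #|E :&: incident v|).
  rewrite (@Ex_local _ _ _ (incident v)); last by move=> E; rewrite -setIA setIid.
  transitivity (Ex p (pairs n :&: incident v) (fun E => 2^-1 ^+ #|E|)); last first.
    apply: eq_Ex => E sE; congr (_ ^+ #|pred_of_set _|).
    by apply/esym/setIidPl; apply: subset_trans sE (subsetIr _ _).
  rewrite (Ex_card p _ (fun k => 2^-1 ^+ k)) card_incident Eb_geom.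
  by congr (_ ^+ _); lra.
rewrite -ExZ; apply: le_Ex => // E sE; rewrite card_nbrs //.
case: ltnP => [lt|_]; last by rewrite mulr_ge0 ?exprn_ge0 ?invr_ge0.
rewrite -(subnKC (ltnW lt)) exprD exprVn mulrAC divff ?mul1r ?exprn_ege1 //.
  by lra.
by rewrite expf_neq0 ?pnatr_eq0.
Qed.

End Edges.

(** * Rounds one and two: the votes of the neighbours of a vertex *)

Section SecondRound.
Variables (R : realType) (p : R) (n : nat) (s : {ffun 'I_n -> bool}).
Hypothesis p01 : 0 <= p <= 1.
Implicit Types (u v w : 'I_n) (E : {set {set 'I_n}}).

Definition nsum E u : int := \sum_(w | adj E w u) spin (s w).

(* The threshold [2] makes [hvote u E] a lower bound for the state of [u] after
   one round whatever the state of one further neighbour [v]. *)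
Definition hvote u E : R := sgb R (2 <= nsum E u).

(** The edges still random once the neighbourhood of [v] is exposed. *)
Definition away v := pairs n :\: incident v.

Lemma hvote_local u E : hvote u E = hvote u (E :&: incident u).
Proof.
rewrite /hvote /nsum; congr (sgb _ (_ <= _)); apply: eq_bigl => w.
by rewrite /adj !inE eqxx orbT andbT.
Qed.

Lemma hvote_sqr u E : hvote u E ^+ 2 = 1.
Proof. by rewrite /hvote /sgb; case: ifP; rewrite ?sqrrN expr1n. Qed.

(** Besides edges of [E2], a neighbour [u] of [v] has only the edge to [v], which shifts its sum by
    one; so [hvote u E2] never exceeds its state after one round. *)
Lemma second_round_vote v E1 E2 :
  E1 \subset pairs n :&: incident v -> E2 \subset away v ->
  0 < \sum_(u in nbrs E1 v) hvote u E2 -> maj_iter (E1 :|: E2) 2 s v = true.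
Proof.
move=> s1 s2 pos; rewrite /maj_iter /= /maj_step ffunE.
set S1 := [ffun v => _]; suff -> : 0 < \sum_(u | adj (E1 :|: E2) u v) spin (S1 u).
  by [].
have E2v w : adj E2 w v = false.
  by apply/negP => /(subsetP s2); rewrite !inE eqxx orbT.
have E1P : E1 \subset pairs n by apply: subset_trans s1 (subsetIl _ _).
rewrite (eq_bigl (mem (nbrs E1 v))); last first.
  by move=> u; rewrite /= !inE /adj inE -/(adj E2 u v) E2v orbF.
rewrite -(ltr0z R); apply: (lt_le_trans pos).
rewrite rmorph_sum /=; apply: ler_sum => u; rewrite inE => uv.
rewrite /hvote /sgb; case: ifP => [h2|_]; last first.
  by case: (S1 u) => //=; rewrite -[- 1]/((-1)%:~R) ler_int.
have uNv : u != v by apply: contraTneq uv => ->; apply: adj_irr.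
suff -> : S1 u = true by [].
rewrite ffunE (bigD1 v) /=; last by rewrite /adj inE setUC [_ \in E1]uv.
rewrite (eq_bigl (adj E2 ^~ u)); last first.
  move=> w; rewrite /adj inE; case: (eqVneq w v) => [->|wv].
    by rewrite andbF setUC -/(adj E2 u v) E2v.
  rewrite andbT; case e1: (_ \in E1) => //=.
  have := subsetP s1 _ e1; rewrite !inE (eq_sym v w) (negPf wv).
  by rewrite (eq_sym v u) (negPf uNv) andbF.
rewrite -/(nsum E2 u); suff -> : 0 < spin (s v) + nsum E2 u by [].
rewrite /spin; case: (s v); lia.
Qed.

(** Apart from [v], the vertex [u] can see [b] vertices in state -1 and [b + d] in state +1. The two
    edge counts are independent binomials, the larger splits as [i + y], and [2 <= nsum] reads
    [j + 2 <= i + y], the event of [Eb_bias]. *)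
Lemma hvote_mean u v (b d l w : nat) : u != v ->
  b = #|[set x | ~~ s x && (x != u) && (x != v)]| ->
  (b + d)%N = #|[set x | s x && (x != u) && (x != v)]| ->
  (2 < l)%N -> (0 < w)%N ->
  16 <= d%:R * p -> 2 * l%:R <= d%:R * p -> 2 * (b%:R * p) <= w%:R ^+ 2 ->
  (8 * ((2 * w) %/ l.-1).+1%:R)^-1 <= Ex p (away v) (hvote u).
Proof.
set WB := [set x | _]; set WA := [set x | s x && _ && _].
move=> uv bE bdE l3 w0 h1 h2 h3.
pose phi x : {set 'I_n} := [set x; u].
have uA : u \notin WA by rewrite !inE eqxx andbF.
have uB : u \notin WB by rewrite !inE eqxx andbF.
rewrite (Ex_local _ _ (hvote_local u)).
have -> : away v :&: incident u = [set phi x | x in WA] :|: [set phi x | x in WB].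
  rewrite -imsetU; apply/setP => e; rewrite !inE.
  apply/andP/imsetP => [[/andP[ve eP] ue]|[x]].
    have : e \in pairs n :&: incident u by rewrite !inE eP.
    rewrite pairs_incident => /imsetP[x xu ex]; exists x => //.
    have xv : x != v by apply: contraNneq ve => <-; rewrite ex !inE eqxx.
    by rewrite !inE in xu *; rewrite xu xv; case: (s x).
  rewrite !inE => xW ->; rewrite /phi !inE cards2 eqxx orbT.
  have [xu xv] : x != u /\ x != v by move: xW; case: (s x); case: (x == u); case: (x == v).
  by rewrite xu (eq_sym v x) (eq_sym v u) (negPf xv) (negPf uv).
have dAB : [disjoint [set phi x | x in WA] & [set phi x | x in WB]].
  rewrite -setI_eq0; apply/eqP/setP => e; rewrite in_set0 inE; apply/negP.
  case/andP => /imsetP[x xA ->] /imsetP[y yB /set2_injl e'].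
  have xy : x = y by apply: e'; apply: contraNneq uA => <-.
  by move: xA yB; rewrite -xy !inE; case: (s x).
rewrite ExU // .
have E12 E1 E2 : E1 \subset [set phi x | x in WA] ->
    E2 \subset [set phi x | x in WB] ->
    hvote u (E1 :|: E2) = sgb R (#|E2| + 2 <= #|E1|)%N.
  move=> s1 s2; rewrite /hvote; congr (sgb _ _).
  have -> : nsum (E1 :|: E2) u = #|E1|%:Z - #|E2|%:Z.
    rewrite -(card_nbrs_star uA s1) -(card_nbrs_star uB s2) /nsum.
    rewrite (bigID (mem (nbrs E1 u))) /=; congr (_ + _).
      rewrite (eq_bigl (mem (nbrs E1 u))) => [|x]; last first.
        by rewrite /= !inE /adj inE; case: (_ \in E1); rewrite ?andbT ?andbF.
      rewrite (eq_bigr (fun=> 1)) ?sumr_const ?natz // => x; rewrite !inE => xE.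
      case/imsetP: (subsetP s1 _ xE) => y yA /esym ey.
      rewrite -(set2_injl _ ey); last by apply: contraNneq uA => <-.
      by move: yA; rewrite !inE; case: (s y).
    rewrite (eq_bigl (mem (nbrs E2 u))) => [|x]; last first.
      rewrite /= !inE /adj inE; case e1: (_ \in E1); case e2: (_ \in E2) => //=.
      have := subsetP s1 _ e1; rewrite (disjointFl dAB) //.
      exact: subsetP s2 _ e2.
    rewrite (eq_bigr (fun=> -1)) ?sumr_const ?mulNrn ?natz // => x.
    rewrite !inE => xE; case/imsetP: (subsetP s2 _ xE) => y yA /esym ey.
    rewrite -(set2_injl _ ey); last by apply: contraNneq uB => <-.
    by move: yA; rewrite !inE; case: (s y).
  by apply/idP/idP; lia.
have cA : #|[set phi x | x in WA]| = (b + d)%N.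
  by rewrite bdE card_in_imset //; apply: set2_inj_in.
have cB : #|[set phi x | x in WB]| = b.
  by rewrite bE card_in_imset //; apply: set2_inj_in.
rewrite (@eq_Ex _ _ _ _ _ (fun E1 => Eb p b (fun j => sgb R (j + 2 <= #|E1|)%N))).
  rewrite (Ex_card p _ (fun k => Eb p b (fun j => sgb R (j + 2 <= k)%N))) cA Eb_add.
  apply: le_trans (Eb_bias p01 l3 w0 h1 h2 h3) _.
  by rewrite le_eqVlt; apply/orP; left; apply/eqP/eq_Eb => i; rewrite Eb_exchange.
move=> E1 s1; rewrite -cB -(Ex_card p _ (fun j => sgb R (j + 2 <= #|E1|)%N)).
by apply: eq_Ex => E2 s2; apply: E12.
Qed.

(** The diagonal gives at most [#|N|]. Off it, a product of two coefficients is at most half the sum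
    of their squares, and Bessel's inequality bounds each row of squares by 1, which gives [#|N|]
    again. *)
Lemma hvote_sum_var v (N : {set 'I_n}) : v \notin N ->
  Ex p (away v) (fun E => (\sum_(u in N) hvote u E) ^+ 2) -
  Ex p (away v) (fun E => \sum_(u in N) hvote u E) ^+ 2 <= 2 * #|N|%:R.
Proof.
move=> vN; set P := away v; pose D u u' := Dx p P [set u; u'] (hvote u).
have p1p : 0 <= p * (1 - p) by case/andP: p01 => ? ?; rewrite mulr_ge0 ?subr_ge0.
have eP u u' : u \in N -> u' \in N -> u != u' -> [set u; u'] \in P.
  move=> uN u'N uu'; rewrite inE pairs_set2 uu' andbT !inE.
  by apply/negP => /orP[] /eqP e; rewrite e ?uN ?u'N in vN.
have cov u u' : u \in N -> u' \in N -> u != u' ->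
    Ex p P (fun E => hvote u E * hvote u' E) - Ex p P (hvote u) * Ex p P (hvote u')
    <= p * (1 - p) * (D u u' ^+ 2) / 2 + p * (1 - p) * (D u' u ^+ 2) / 2.
  move=> uN u'N uu'.
  rewrite (@Ex_cov _ _ _ (incident u) (incident u') _ [set u; u']) ?eP //.
  - rewrite /D [in X in _ <= _ + X]setUC; set x := Dx _ _ _ _; set y := Dx _ _ _ _.
    by have := mulr_ge0 p1p (sqr_ge0 (x - y)); nra.
  - exact: hvote_local.
  - exact: hvote_local.
  apply/subsetP => e /setIP[/setIP[/setDP[eP' _] ue] ue'].
  by rewrite !inE in ue ue' *; apply/eqP; apply: pair_eq.
have bes u : u \in N -> \sum_(u' in N | u' != u) p * (1 - p) * D u u' ^+ 2 <= 1.
  move=> uN; have := @bessel R p _ p01 P [set [set u'; u] | u' in N :\ u] (hvote u).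
  rewrite big_imset /=; last by apply: set2_inj_in; rewrite !inE eqxx.
  rewrite (@eq_Ex _ _ _ _ _ (fun=> 1)) => [|E _]; last exact: hvote_sqr.
  rewrite Ex_cst => H; apply: le_trans (H _).
    rewrite le_eqVlt; apply/orP; left; apply/eqP; apply: eq_big => [u'|u' _].
      by rewrite !inE andbC.
    by rewrite /D setUC.
  by apply/subsetP => e /imsetP[u' /setD1P[ne u'N] ->]; apply: eP.
rewrite Ex_sum expr2 mulr_suml.
rewrite (@eq_Ex _ _ _ _ _
   (fun E => \sum_(u in N) \sum_(u' in N) hvote u E * hvote u' E)); last first.
  by move=> E _; rewrite expr2 mulr_suml; apply: eq_bigr => u _; rewrite mulr_sumr.
rewrite Ex_sum -sumrB.
apply: (@le_trans _ _ (\sum_(u in N) (1 + \sum_(u' in N | u' != u)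
   (p * (1 - p) * (D u u' ^+ 2) / 2 + p * (1 - p) * (D u' u ^+ 2) / 2)))).
  apply: ler_sum => u uN; rewrite Ex_sum mulr_sumr -sumrB (bigD1 u) //=.
  apply: lerD; last first.
    by apply: ler_sum => u' /andP[u'N uu']; apply: cov => //; rewrite eq_sym.
  rewrite (@eq_Ex _ _ _ _ _ (fun=> 1)) => [|E _]; last by rewrite -expr2 hvote_sqr.
  by rewrite Ex_cst; have := sqr_ge0 (Ex p P (hvote u)); nra.
rewrite big_split /= sumr_const.
under eq_bigr do rewrite big_split /=.
rewrite big_split /=.
have H1 : \sum_(u in N) \sum_(u' in N | u' != u) p * (1 - p) * D u u' ^+ 2 / 2
  <= #|N|%:R / 2.
  apply: (@le_trans _ _ (\sum_(u in N) 1 / 2)).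
    apply: ler_sum => u uN; rewrite -mulr_suml; have := bes u uN; lra.
  by rewrite -mulr_suml sumr_const.
have H2 : \sum_(u in N) \sum_(u' in N | u' != u) p * (1 - p) * D u' u ^+ 2 / 2
  <= #|N|%:R / 2.
  rewrite (exchange_big_dep (mem N)) /=; last by move=> u u' _ /andP[].
  apply: le_trans H1; rewrite le_eqVlt; apply/orP; left; apply/eqP.
  apply: eq_bigr => u uN; apply: eq_bigl => u'; by rewrite uN eq_sym.
by lra.
Qed.

(** The edges at [v] are exposed first. With fewer than [k] of them the bound is trivial; otherwise
    Chebyshev's inequality over the other edges gives [2 / (kappa ^ 2 * #|N|)]. *)
Lemma prob_second_round v (k : nat) (kappa : R) : (0 < k)%N -> 0 < kappa ->
  (forall u, u != v -> kappa <= Ex p (away v) (hvote u)) ->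
  Ex p (pairs n) (fun E => (~~ maj_iter E 2 s v)%:R) <=
  Ex p (pairs n) (fun E => (#|nbrs E v| < k)%N%:R) + 2 / (kappa ^+ 2 * k%:R).
Proof.
move=> k0 kap0 mean; have k0R : 0 < k%:R :> R by rewrite ltr0n.
rewrite (ExID _ (incident v)) [X in _ <= X + _](ExID _ (incident v)).
set eta := 2 / _; have eta0 : 0 <= eta.
  by rewrite divr_ge0 // mulr_ge0 ?sqr_ge0 // ltW.
rewrite -[X in _ + X](Ex_cst p (pairs n :&: incident v)) -ExD.
apply: le_Ex => // E1 s1; have E1P : E1 \subset pairs n.
  by apply: subset_trans s1 (subsetIl _ _).
have nbE E2 : E2 \subset away v -> nbrs (E1 :|: E2) v = nbrs E1 v.
  move=> s2; apply/setP => u; rewrite !inE /adj inE.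
  case e2: (_ \in E2); rewrite ?orbF //.
  by move/(subsetP s2): e2; rewrite !inE eqxx orbT.
have [lt|ge] := ltnP #|nbrs E1 v| k.
  rewrite [X in _ <= X + _](@eq_Ex _ _ _ _ _ (fun=> 1)) => [|E2 s2]; last by rewrite nbE // lt.
  rewrite Ex_cst -[leLHS]addr0 lerD //.
  by rewrite -[leRHS](Ex_cst p (pairs n :\: incident v)); apply: le_Ex => // E _; case: (~~ _).
rewrite [X in _ <= X + _](@eq_Ex _ _ _ _ _ (fun=> 0)) => [|E2 s2]; last first.
  by rewrite nbE // ltnNge ge.
rewrite Ex_cst add0r; set N := nbrs E1 v in ge *.
have vN : v \notin N by rewrite inE adj_irr.
pose f E := \sum_(u in N) hvote u E.
apply: (@le_trans _ _ (Ex p (away v) (fun E => (f E <= 0)%R%:R))).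
  apply: le_Ex => // E2 s2; have := @second_round_vote v E1 E2 s1 s2.
  rewrite -/N -/(f E2); case: lerP => [_ _|_ /(_ isT) ->//].
  by case: (~~ _).
have fm : kappa * #|N|%:R <= Ex p (away v) f.
  rewrite Ex_sum mulr_natr -sumr_const; apply: ler_sum => u uN; apply: mean.
  by apply: contraNneq vN => <-.
have N0 : 0 < #|N|%:R :> R by rewrite ltr0n; apply: leq_trans ge.
have f0 : 0 < Ex p (away v) f by apply: lt_le_trans fm; rewrite mulr_gt0.
apply: le_trans (chebyshev_le0 p01 f0) _.
apply: (@le_trans _ _ (2 * #|N|%:R / (kappa * #|N|%:R) ^+ 2)).
  apply: ler_pM.
  (* The variance is nonnegative because Chebyshev's bound dominates a probability. *)
  - have := chebyshev_le0 p01 f0 => /(le_trans _) H.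
    have : 0 <= Ex p (away v) (fun E => (f E <= 0)%R%:R) by apply: Ex_ge0.
    by move/H; rewrite pmulr_lge0 // invr_gt0 exprn_gt0.
  - by rewrite invr_ge0 sqr_ge0.
  - exact: hvote_sum_var.
  rewrite lef_pV2 ?posrE ?exprn_gt0 ?mulr_gt0 //.
  by rewrite ler_pXn2r ?nnegrE ?mulr_ge0 // ltW.
have -> : 2 * #|N|%:R / (kappa * #|N|%:R) ^+ 2 = 2 / (kappa ^+ 2 * #|N|%:R).
  by field; rewrite !gt_eqF.
rewrite /eta ler_pM2l // lef_pV2 ?posrE ?mulr_gt0 ?exprn_gt0 //.
by rewrite ler_pM2l ?exprn_gt0 // ler_nat.
Qed.

End SecondRound.

(** * Rounds three and four: small wrong sets shrink and vanish *)

Section LateRounds.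
Variables (R : realType) (p : R) (n : nat).
Hypothesis p01 : 0 <= p <= 1.
Implicit Types (u v w : 'I_n) (E : {set {set 'I_n}}) (S T : {set 'I_n}).

(** The total vote cast into [T] when [S] is the set of vertices in state -1; an edge inside [T]
    counts once from each end. *)
Definition bal S T E : int := \sum_(v in T) \sum_(u | adj E u v) spin (u \notin S).

Lemma set2_eq u x y : x != y -> ([set u; x] == [set x; y]) = (u == y).
Proof.
move=> xy; apply/eqP/eqP => [e|->]; last by rewrite setUC.
have : y \in [set u; x] by rewrite e !inE eqxx orbT.
by rewrite !inE (eq_sym y x) (negPf xy) orbF => /eqP.
Qed.

(* Exponential moment with weight [2] on [S] and [1/2] off [S]. An edge inside
   [T] carries a product of two weights; [2] and [-3/8] are chosen so that
   [w w' - 1] is still bounded by the sum of the two contributions. *)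
Lemma prob_bal S T :
  Ex p (pairs n) (fun E => (bal S T E <= 0)%R%:R) <=
  expR (p * \sum_(v in T) \sum_(u | u != v) (19 / 8 * (u \in S)%:R - 3 / 8)).
Proof.
case/andP: (p01) => p0 p1.
pose w u : R := 2 ^ (- spin (u \notin S)).
pose f u : R := 19 / 8 * (u \in S)%:R - 3 / 8.
have w0 u : 0 < w u by rewrite exprz_gt0.
have wE u : w u = if u \in S then 2 else 2^-1.
  by rewrite /w /spin; case: (u \in S).
have n20 : (2 : R) != 0 by rewrite pnatr_eq0.
(* The weight of an edge is the product, over its ends in [T], of the weight of the opposite end. *)
pose W (e : {set 'I_n}) : R := \prod_(v in T) \prod_(u | [set u; v] == e) w u.
apply: (@le_trans _ _ (Ex p (pairs n) (fun E => \prod_(e in E) W e))).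
  apply: le_Ex => // E sE.
  have -> : \prod_(e in E) W e = 2 ^ (- bal S T E).
    have morph : {morph (fun z : int => (2 : R) ^ (- z)) : x y / x + y >-> x * y}.
      by move=> x y; rewrite opprD expfzDr.
    rewrite /bal (big_morph _ morph (erefl _)) /W exchange_big /=.
    apply: eq_bigr => v _; rewrite (big_morph _ morph (erefl _)).
    rewrite (partition_big (fun u => [set u; v]) (mem E)) //=.
    apply: eq_bigr => e eE; apply: eq_bigl => u.
    by rewrite /adj; case: eqP => [->|]; rewrite ?andbF ?andbT ?eE.
  case: (lerP (bal S T E) 0) => [b0|_]; last by rewrite ltW // exprz_gt0.
  have -> : - bal S T E = `|- bal S T E|%N%:Z by lia.
  by rewrite -exprnP exprn_ege1 //; lra.
rewrite Ex_prod.
apply: (@le_trans _ _ (\prod_(e in pairs n) expR (p * (W e - 1)))).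
  apply: ler_prod => e eP; apply/andP; split.
    rewrite addr_ge0 ?subr_ge0 // mulr_ge0 //.
    by apply: prodr_ge0 => v _; apply: prodr_ge0 => u _; rewrite ltW.
  by apply: le_trans (expR_ge1Dx _); lra.
rewrite -expR_sum ler_expR -mulr_sumr; apply: ler_wpM2l => //.
apply: (@le_trans _ _ (\sum_(e in pairs n) \sum_(v in T)
    \sum_(u | [set u; v] == e) f u)); last first.
  rewrite exchange_big /= le_eqVlt; apply/orP; left; apply/eqP.
  apply: eq_bigr => v vT.
  rewrite [RHS](partition_big (fun u => [set u; v]) (mem (pairs n))) /=; last first.
    by move=> u uv; rewrite pairs_set2.
  apply: eq_bigr => e eP; apply: eq_bigl => u.
  case: eqP => [h|]; last by rewrite andbF.
  by rewrite andbT -pairs_set2 h.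
apply: ler_sum => e eP.
have [x [y [xy ->]]] : exists x y, x != y /\ e = [set x; y].
  move: eP; rewrite inE => /cards2P[x [y [xy ->]]]; by exists x, y.
have rest v : v != x -> v != y -> (fun u => [set u; v] == [set x; y]) =1 xpred0.
  move=> vx vy u; apply/eqP => h; have : v \in [set x; y] by rewrite -h !inE eqxx orbT.
  by rewrite !inE (negPf vx) (negPf vy).
have eqx u : ([set u; x] == [set x; y]) = (u == y) by rewrite set2_eq.
have eqy u : ([set u; y] == [set x; y]) = (u == x).
  by rewrite (setUC [set x]) set2_eq // eq_sym.
have -> : W [set x; y] = (if x \in T then w y else 1) * (if y \in T then w x else 1).
  rewrite /W big_mkcond (bigD1 x) //= [X in _ * X](bigD1 y) /=; last by rewrite eq_sym.
  rewrite [X in _ * (_ * X)]big1 => [|v /andP[vx vy]]; last first.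
    by rewrite big_pred0 ?if_same //; apply: rest.
  by rewrite mulr1 (eq_bigl _ _ eqx) (eq_bigl _ _ eqy) !big_pred1_eq.
have -> : \sum_(v in T) \sum_(u | [set u; v] == [set x; y]) f u =
   (if x \in T then f y else 0) + (if y \in T then f x else 0).
  rewrite big_mkcond (bigD1 x) //= [X in _ + X](bigD1 y) /=; last by rewrite eq_sym.
  rewrite [X in _ + (_ + X)]big1 => [|v /andP[vx vy]]; last first.
    by rewrite big_pred0 ?if_same //; apply: rest.
  by rewrite addr0 (eq_bigl _ _ eqx) (eq_bigl _ _ eqy) !big_pred1_eq.
(* The tight case is an edge inside [T] with both ends off [S]: [1 / 4 - 1 = - 3 / 8 - 3 / 8]. *)
rewrite !wE /f.
by case: (x \in T); case: (y \in T); case: (x \in S); case: (y \in S);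
  rewrite /= ?mulr1 ?mul1r ?mulr0 ?divff //; lra.
Qed.

(** Each vertex of [T] contributes at most [19 / 8 * n / 20 - 3 / 8 * (n - 1)], which is at most
    [- n / 5] as soon as [n >= 20 / 3]; hence [7 <= n]. *)
Lemma prob_bal_le S T (t : nat) : (7 <= n)%N -> (20 * #|S| <= n)%N ->
  (t <= #|T|)%N ->
  Ex p (pairs n) (fun E => (bal S T E <= 0)%R%:R) <= expR (- (p * t%:R * n%:R / 5)).
Proof.
move=> n7 Sn tT; apply: le_trans (prob_bal S T) _; rewrite ler_expR.
have [p0 _] := andP p01.
have n7R : 7 <= n%:R :> R by rewrite ler_nat.
have SnR : 20 * #|S|%:R <= n%:R :> R by rewrite -natrM ler_nat.
have tTR : t%:R <= #|T|%:R :> R by rewrite ler_nat.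
have -> : - (p * t%:R * n%:R / 5) = p * - (n%:R / 5 * t%:R) by ring.
apply: ler_wpM2l => //.
apply: (@le_trans _ _ (\sum_(v in T) - (n%:R / 5 : R))).
  apply: ler_sum => v _; rewrite sumrB -mulr_sumr sumr_const.
  have -> : #|(fun u => u != v)| = n.-1.
    by rewrite -[LHS]/#|predC1 v| cardC1 card_ord.
  have : \sum_(u | u != v) (u \in S)%:R <= #|S|%:R :> R.
    rewrite -sum1_card natr_sum [leRHS]big_mkcond /=.
    rewrite [leLHS]big_mkcond /=; apply: ler_sum => u _.
    by case: (u != v); case: (u \in S).
  have -> : 3 / 8 *+ n.-1 = 3 / 8 * (n%:R - 1) :> R.
    by rewrite -[LHS]mulr_natr -subn1 natrB //; lia.
  by lra.
by rewrite sumr_const -[leLHS]mulr_natr mulNr lerN2 ler_wpM2l //; lra.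
Qed.

Definition unbalanced (t : nat) E : bool :=
  [exists S : {set 'I_n}, exists T : {set 'I_n},
    [&& (20 * #|S| <= n)%N, (t <= #|T|)%N & bal S T E <= 0]].

Lemma indicator_exists_le (J : finType) (K : pred J) :
  ([exists j, K j]%:R : R) <= \sum_j (K j)%:R.
Proof.
case: existsP => [[j Kj]|_]; last by apply: sumr_ge0.
by rewrite (bigD1 j) //= Kj lerDl sumr_ge0.
Qed.

Lemma prob_unbalanced (t : nat) : (7 <= n)%N ->
  Ex p (pairs n) (fun E => (unbalanced t E)%:R) <=
  4 ^+ n * expR (- (p * t%:R * n%:R / 5)).
Proof.
move=> n7; set x := expR _.
have cs : #|{: {set 'I_n}}| = (2 ^ n)%N.
  by rewrite -cardsT -powersetT card_powerset cardsT card_ord.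
apply: (@le_trans _ _ (\sum_(S : {set 'I_n}) \sum_(T : {set 'I_n}) x)); last first.
  by rewrite !sumr_const cs -mulrnA -expnMn -[leLHS]mulr_natl natrX.
apply: (@le_trans _ _ (Ex p (pairs n) (fun E => \sum_(S : {set 'I_n})
    \sum_(T : {set 'I_n}) [&& (20 * #|S| <= n)%N, (t <= #|T|)%N & bal S T E <= 0]%R%:R))).
  apply: le_Ex => // E _; apply: le_trans (indicator_exists_le _) _.
  by apply: ler_sum => S _; apply: indicator_exists_le.
rewrite Ex_sum; apply: ler_sum => S _; rewrite Ex_sum; apply: ler_sum => T _.
have [Sn|_] := boolP (20 * #|S| <= n)%N; last by rewrite Ex_cst expR_ge0.
have [tT|_] := boolP (t <= #|T|)%N; last by rewrite Ex_cst expR_ge0.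
exact: prob_bal_le.
Qed.

(** [S] and [T] are the wrong sets after two and three rounds. Vertices of [T] had nonpositive sums
    in round three, so [bal S T E <= 0], and [~~ unbalanced t E] forces [#|T| < t]: fewer than half
    of the neighbours of [v] are wrong. *)
Lemma fourth_round (s : {ffun 'I_n -> bool}) (t : nat) E v :
  (20 * #|[set u | ~~ maj_iter E 2 s u]| <= n)%N -> ~~ unbalanced t E ->
  (2 * t <= #|nbrs E v|)%N -> (0 < t)%N -> maj_iter E 4 s v = true.
Proof.
move=> B2 unb deg t0; rewrite /maj_iter in B2 *.
pose s2 := iter 2 (maj_step E) s; pose s3 := maj_step E s2.
set S := [set u | _] in B2; pose T := [set u | ~~ s3 u].
have T_lt : (#|T| < t)%N.
  rewrite ltnNge; apply: contra unb => tT.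
  apply/existsP; exists S; apply/existsP; exists T; rewrite B2 tT /=.
  apply: sumr_le0 => x; rewrite inE /s3 ffunE => sx.
  rewrite (eq_bigr (fun u => spin (s2 u))); last by move=> u _; rewrite inE negbK.
  by rewrite leNgt; apply: contra sx; cbv zeta => ->.
rewrite -[iter 4 _ _]/(maj_step E s3) ffunE; cbv zeta.
suff -> : 0 < \sum_(u | adj E u v) spin (s3 u) by [].
have -> : \sum_(u | adj E u v) spin (s3 u) =
   \sum_(u | adj E u v) 1 - 2 * \sum_(u | adj E u v) (u \in T)%:R.
  rewrite mulr_sumr -sumrB; apply: eq_bigr => u _; rewrite inE.
  by case: (s3 u).
have -> : \sum_(u | adj E u v) 1 = #|nbrs E v|%:Z.
  rewrite (eq_bigl (mem (nbrs E v))); first by rewrite sumr_const natz.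
  by move=> u; rewrite /= inE.
have : \sum_(u | adj E u v) (u \in T)%:R <= #|T|%:Z.
  rewrite -[#|T|%:Z]natz -sum1_card natr_sum [leRHS]big_mkcond /=.
  rewrite [leLHS]big_mkcond /=; apply: ler_sum => u _.
  by case: (adj E u v); case: (u \in T).
move: (\sum_(u | _) _) deg T_lt => X; move: #|nbrs E v| #|T| => a b.
by lia.
Qed.

(** The failure indicator is at most a sum of three terms: [20 / n] times the number of wrong
    vertices after round two, the indicator of [unbalanced], and the number of vertices of degree
    below [2 * t]. *)
Lemma prob_fourth_round (s : {ffun 'I_n -> bool}) (t : nat) (eta delta : R) :
  (7 <= n)%N -> (0 < t)%N ->
  (forall v, Ex p (pairs n) (fun E => (#|nbrs E v| < 2 * t)%N%:R) <= delta) ->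
  (forall v, Ex p (pairs n) (fun E => (~~ maj_iter E 2 s v)%:R) <= eta) ->
  Ex p (pairs n) (fun E => (~~ [forall v, maj_iter E 4 s v])%:R) <=
  20 * eta + 4 ^+ n * expR (- (p * t%:R * n%:R / 5)) + n%:R * delta.
Proof.
move=> n7 t0 hdelta heta.
have n0 : 0 < n%:R :> R by rewrite ltr0n; lia.
pose B2 E := [set u | ~~ maj_iter E 2 s u].
apply: (@le_trans _ _ (Ex p (pairs n) (fun E =>
   20 / n%:R * \sum_v (~~ maj_iter E 2 s v)%:R + (unbalanced t E)%:R +
   \sum_v (#|nbrs E v| < 2 * t)%N%:R))); last first.
  rewrite !ExD ExZ !Ex_sum; apply: lerD; first apply: lerD.
  - have : \sum_v Ex p (pairs n) (fun E => (~~ maj_iter E 2 s v)%:R) <= n%:R * eta.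
      by rewrite mulr_natl -[X in _ *+ X]card_ord -sumr_const; apply: ler_sum.
    move=> h; rewrite mulrAC ler_pdivrMr //; lra.
  - exact: prob_unbalanced.
  by rewrite mulr_natl -[X in _ *+ X]card_ord -sumr_const; apply: ler_sum.
apply: le_Ex => // E sE.
have h1 : 0 <= 20 / n%:R * \sum_v (~~ maj_iter E 2 s v)%:R :> R.
  by rewrite mulr_ge0 ?sumr_ge0 // divr_ge0 // ltW.
have h3 : 0 <= \sum_v (#|nbrs E v| < 2 * t)%N%:R :> R by apply: sumr_ge0.
have h2 : 0 <= (unbalanced t E)%:R :> R by [].
have [all4|/forallPn[v nv]] := boolP [forall v, maj_iter E 4 s v].
  by rewrite /= !addr_ge0.
rewrite /=; have [unb|unb] := boolP (unbalanced t E); first by rewrite /= in h2 *; lra.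
have [lt|ge] := ltnP #|nbrs E v| (2 * t).
  have : 1 <= \sum_v (#|nbrs E v| < 2 * t)%N%:R :> R.
    by rewrite (bigD1 v) //= lt lerDl sumr_ge0.
  by rewrite /=; lra.
have [B2n|B2n] := leqP (20 * #|B2 E|) n.
  by rewrite (fourth_round B2n unb ge t0) in nv.
have : 1 <= 20 / n%:R * \sum_v (~~ maj_iter E 2 s v)%:R :> R.
  have -> : \sum_v (~~ maj_iter E 2 s v)%:R = #|B2 E|%:R :> R.
    rewrite -sum1_card natr_sum [RHS]big_mkcond /=; apply: eq_bigr => u _.
    by rewrite inE; case: (~~ _).
  rewrite mulrAC ler_pdivlMr // mul1r -natrM ler_nat; lia.
by rewrite /=; lra.
Qed.

End LateRounds.

(** * The initial sum and the symmetry between the two states *)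

Section Magnetization.
Variable n : nat.
Implicit Type s : {ffun 'I_n -> bool}.

Definition magn s : int := \sum_u spin (s u).

Definition flip s : {ffun 'I_n -> bool} := [ffun v => ~~ s v].

Lemma spinN b : spin (~~ b) = - spin b.
Proof. by case: b. Qed.

Lemma magn_flip s : magn (flip s) = - magn s.
Proof. by rewrite /magn -sumrN; apply: eq_bigr => u _; rewrite ffunE spinN. Qed.

(** A tie keeps the state, so the rule commutes with the exchange of the two states at ties as
    well. *)
Lemma maj_step_flip E s : maj_step E (flip s) = flip (maj_step E s).
Proof.
apply/ffunP => v; rewrite !ffunE; cbv zeta.
rewrite (eq_bigr (fun u => - spin (s u))); last by move=> u _; rewrite ffunE spinN.
rewrite sumrN oppr_gt0 oppr_lt0; move: (\sum_(u | _) _) => x.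
by case: (ltrgtP x 0).
Qed.

Lemma maj_iter_flip E t s : maj_iter E t (flip s) = flip (maj_iter E t s).
Proof.
by elim: t => //= t IH; rewrite /maj_iter /= -/(maj_iter E t _) IH maj_step_flip.
Qed.

Lemma all_agree4_flip E s : all_agree4 E (flip s) = all_agree4 E s.
Proof.
rewrite /all_agree4 -/(magn s) -/(magn (flip s)) magn_flip oppr_eq0.
have [//|m0] := eqVneq (magn s) 0; congr (_ && _); apply: eq_forallb => v.
rewrite maj_iter_flip ffunE oppr_gt0.
by case: (ltrgtP (magn s) 0) m0 => // _ _; case: (maj_iter _ _ _ _).
Qed.

Lemma all_agree4_pos E s : 0 < magn s ->
  all_agree4 E s = [forall v, maj_iter E 4 s v].
Proof.
move=> m0; rewrite /all_agree4 -/(magn s) m0 gt_eqF //=.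
by apply: eq_forallb => v; rewrite eqb_id.
Qed.

Lemma magn_card s : magn s = 2 * #|[set u | s u]|%:Z - n%:Z.
Proof.
rewrite /magn (eq_bigr (fun u => 2 * (s u)%:R - 1)); last by move=> u _; case: (s u).
rewrite sumrB sumr_const card_ord -mulr_sumr; congr (_ * _ - _); last by rewrite natz.
rewrite -[RHS]natz -sum1_card natr_sum [RHS]big_mkcond /=; apply: eq_bigr => u _.
by rewrite inE; case: (s u).
Qed.

Lemma magn_except s u v : u != v ->
  magn s - 2 <= #|[set x | s x && (x != u) && (x != v)]|%:Z
              - #|[set x | ~~ s x && (x != u) && (x != v)]|%:Z.
Proof.
move=> uv; rewrite /magn (bigD1 u) //= (bigD1 v) /=; last by rewrite eq_sym.
set A := [set x | s x && _ && _]; set B := [set x | _].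
suff -> : \sum_(x | (x != u) && (x != v)) spin (s x) = #|A|%:Z - #|B|%:Z.
  by case: (s u); case: (s v); rewrite /spin /=; lia.
rewrite (bigID s) /=; congr (_ + _).
  rewrite (eq_bigr (fun=> 1)) => [|x /andP[_ ->] //].
  rewrite -[#|A|%:Z]natz -sumr_const; apply: eq_bigl => x.
  by rewrite !inE andbC andbA.
rewrite (eq_bigr (fun=> -1)) => [|x /andP[_ /negPf ->] //].
rewrite -[#|B|%:Z]natz sumrN -sumr_const; congr (- _); apply: eq_bigl => x.
by rewrite !inE andbC andbA.
Qed.

Lemma card_spins_le (k : nat) :
  (#|[set s : {ffun 'I_n -> bool} | #|[set u | s u]| == k]| <= 'C(n, k))%N.
Proof.
have inj : injective (fun s : {ffun 'I_n -> bool} => [set u | s u]).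
  by move=> s s' /setP e; apply/ffunP => u; have := e u; rewrite !inE.
rewrite -(card_imset _ inj) -[n in 'C(n, k)]card_ord -card_draws.
apply: subset_leq_card; apply/subsetP => A /imsetP[s]; rewrite inE => sk ->.
by rewrite inE.
Qed.

End Magnetization.

(** * Anti-concentration of the initial sum through binomial coefficients *)

Lemma leq_bin_middle j k : ('C(2 * j, k) <= 'C(2 * j, j))%N.
Proof.
have low i : (i <= j)%N -> ('C(2 * j, i) <= 'C(2 * j, j))%N.
  move=> ij; rewrite -(subKn ij); elim: (j - i)%N (leq_subr i j) => [|d IH] dj.
    by rewrite subn0.
  apply: leq_trans (IH (ltnW dj)).
  have := mul_bin_left (2 * j) (j - d.+1); have -> : (j - d.+1).+1 = (j - d)%N by lia.
  by move=> e; rewrite -(@leq_pmul2l (j - d)) ?subn_gt0 // e leq_mul2r; lia.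
have [kj|jk] := leqP k j; first exact: low.
have [k2|k2] := leqP k (2 * j); last by rewrite bin_small.
by rewrite -bin_sub // low; lia.
Qed.

(** Consecutive central coefficients have ratio [2 (2j + 1) / (j + 1)], so the induction step
    amounts to [(2j + 1) (2j + 3) <= (2j + 2) ^ 2]. *)
Lemma central_bin_bound j : ('C(2 * j, j) ^ 2 * (2 * j).+1 <= 16 ^ j)%N.
Proof.
elim: j => [|j IH] //.
have e : (j.+1 * 'C(2 * j.+1, j.+1) = 2 * (2 * j).+1 * 'C(2 * j, j))%N.
  have := mul_bin_diag (2 * j).+2 j; have := mul_bin_down (2 * j).+1 j.
  rewrite (_ : 2 * j.+1 = (2 * j).+2)%N; last by lia.
  rewrite (_ : (2 * j).+1 - j = j.+1)%N; last by lia.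
  move=> /= e1 <-; rewrite -mulnA e1 mulnA; congr (_ * _)%N; lia.
rewrite -(@leq_pmul2l (j.+1 ^ 2)) // mulnA -expnMn e.
apply: (@leq_trans (j.+1 ^ 2 * (16 * ('C(2 * j, j) ^ 2 * (2 * j).+1)))).
  by move: 'C(_, _) => c; nia.
by rewrite leq_mul2l [(16 ^ _.+1)%N]expnS leq_mul2l IH !orbT.
Qed.

(** For odd [n] and positive [k], Pascal's rule gives a sum [a + b] of two coefficients of even
    order, and [(a + b) ^ 2 <= 2 (a ^ 2 + b ^ 2)]. *)
Lemma bin_bound n k : ('C(n, k) ^ 2 * n <= 4 ^ n)%N.
Proof.
have h j i : ('C(2 * j, i) ^ 2 * (2 * j).+1 <= 16 ^ j)%N.
  apply: leq_trans (central_bin_bound j).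
  by rewrite leq_mul2r leq_exp2r // leq_bin_middle orbT.
have -> : n = (odd n + 2 * n./2)%N by rewrite mul2n odd_double_half.
move: n./2 => j; case: (odd n); rewrite ?add1n ?add0n.
  rewrite [(4 ^ _)%N]expnS expnM; case: k => [|k].
    by rewrite bin0; have := h j 0; rewrite bin0 -[(4 ^ 2)%N]/16%N; lia.
  rewrite binS -[(4 ^ 2)%N]/16%N; have := h j k; have := h j k.+1.
  by move: 'C(_, _) 'C(_, _) (16 ^ _)%N => a b c; nia.
by rewrite expnM; apply: leq_trans (h j k); rewrite leq_mul2l leqnSn orbT.
Qed.

Lemma bin_sqrt_bound (R : realType) n k :
  ('C(n, k))%:R * Num.sqrt n%:R <= 2 ^+ n :> R.
Proof.
rewrite -(@ler_pXn2r _ 2) ?nnegrE ?mulr_ge0 ?sqrtr_ge0 ?exprn_ge0 //.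
rewrite exprMn sqr_sqrtr // (_ : (2 ^+ n) ^+ 2 = (4 ^ n)%N%:R :> R).
  by rewrite -natrX -natrM ler_nat bin_bound.
by rewrite natrX exprAC -natrX.
Qed.

(** A small sum confines the number of +1 vertices to [D + 1] consecutive values, each of
    probability at most [1 / sqrt n], and [D <= delta * sqrt n + 1]. *)
Lemma balanced_spins_bound (R : realType) n (delta : R) : 0 <= delta ->
  (0 < n)%N ->
  \sum_(s : {ffun 'I_n -> bool})
    (`|(magn s)%:~R| < delta * Num.sqrt n%:R)%R%:R / 2 ^+ n
  <= delta + 2 / Num.sqrt n%:R.
Proof.
move=> d0 n0; have window (c D : nat) : (`|(2 * c%:Z - n%:Z)%R| < D)%N ->
    ((n - D).+1 %/ 2 <= c < (n - D).+1 %/ 2 + D.+1)%N by lia.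
set r := Num.sqrt n%:R.
have r0 : 0 < r by rewrite sqrtr_gt0 ltr0n.
have dr0 : 0 <= delta * r by rewrite mulr_ge0 // ltW.
pose D := (Num.truncn (delta * r)).+1; pose a := ((n - D).+1 %/ 2)%N.
have /andP[Dl Du] : (Num.truncn (delta * r))%:R <= delta * r < D%:R by exact: truncn_itv.
have p2 : 0 < 2 ^+ n :> R by rewrite exprn_gt0.
rewrite -mulr_suml ler_pdivrMr //.
apply: (@le_trans _ _ (\sum_(s : {ffun 'I_n -> bool})
   \sum_(i < D.+1) (#|[set u | s u]| == a + i)%N%:R)).
  apply: ler_sum => s _; case: ltrP => [lt|_]; last by apply: sumr_ge0.
  have lt' : (`|magn s| < D)%N.
    by rewrite -(ltr_nat R) natr_absz intr_norm; apply: lt_trans Du.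
  rewrite magn_card in lt'; case/andP: (window _ _ lt'); rewrite -/a => al au.
  have iP : (#|[set u | s u]| - a < D.+1)%N by rewrite ltn_subLR.
  rewrite (bigD1 (Ordinal iP)) //= (_ : _ == _ = true) ?lerDl ?sumr_ge0 //.
  by rewrite subnKC ?eqxx.
rewrite exchange_big /=.
apply: (@le_trans _ _ (\sum_(i < D.+1) 2 ^+ n / r)).
  apply: ler_sum => i _; rewrite ler_pdivlMr //.
  apply: le_trans (bin_sqrt_bound R n (a + i)); rewrite ler_pM2r //.
  apply: (@le_trans _ _
    #|[set s : {ffun 'I_n -> bool} | #|[set u | s u]| == (a + i)%N]|%:R).
    rewrite -sum1_card natr_sum [leRHS]big_mkcond /=; apply: ler_sum => s _.
    by rewrite inE; case: (_ == _).
  by rewrite ler_nat card_spins_le.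
rewrite sumr_const card_ord -[leLHS]mulr_natr mulrAC ler_pdivrMr //.
have -> : (delta + 2 / r) * 2 ^+ n * r = 2 ^+ n * (delta * r + 2).
  by field; rewrite gt_eqF.
rewrite ler_pM2l // /D -!natr1; lra.
Qed.

(** * Numerical estimates for one initial state with a large positive sum *)

Section GoodState.
Variables (R : realType) (eps delta p : R) (n : nat).
Let r := Num.sqrt n%:R : R.
Hypothesis eps01 : 0 < eps <= 1.
Hypothesis delta01 : 0 < delta <= 1.
Hypothesis p1 : p <= 1.
Hypothesis r_big : 4 <= delta * r.
Hypothesis n_big : 84 <= n%:R * eps.
Hypothesis lam_p : 200 * 200 <= p * r * (delta * eps).

Let r0 : 0 < r.
Proof. by have := r_big; case/andP: delta01 => ? ?; nra. Qed.
Let rr : r ^+ 2 = n%:R.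
Proof. by rewrite sqr_sqrtr. Qed.
Let n84 : 84 <= n%:R :> R.
Proof. by case/andP: eps01 => ? ?; have := n_big; have : 0 <= n%:R :> R by []; nra. Qed.
Let de01 : 0 < delta * eps <= 1.
Proof.
case/andP: eps01 => ? ?; case/andP: delta01 => ? ?.
by rewrite mulr_gt0 //= mulr_ile1 // ltW.
Qed.
Let pr : 200 * 200 <= p * r.
Proof. by have := lam_p; case/andP: de01 => ? ?; have [|] := lerP 0 (p * r); nra. Qed.
Let prd : 200 * 200 <= p * r * delta.
Proof.
have : 0 < p * r * delta.
  by rewrite mulr_gt0 //; [have := pr; lra | case/andP: delta01].
by have := lam_p; case/andP: eps01 => ? ?; nra.
Qed.
Let p0 : 0 < p.
Proof. by rewrite -(pmulr_lgt0 _ r0); have := pr; lra. Qed.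
Let p01 : 0 <= p <= 1.
Proof. by rewrite p1 andbT ltW. Qed.
Let r1 : 1 <= r.
Proof.
by have := rr; have := n84; have := r0; rewrite expr2; nra.
Qed.
Let np : n%:R * p = p * r * r.
Proof. by rewrite -rr; ring. Qed.

(** Small enough that degrees below [2 * t <= n p / 8] are exponentially rare, large enough that
    [p * t >= 100] beats the union bound. *)
Let t := Num.truncn (n%:R * p / 16).

Lemma t_bounds : t%:R <= n%:R * p / 16 /\ n%:R * p / 32 <= t%:R :> R.
Proof.
have npb : 200 * 200 <= n%:R * p by rewrite np; have := pr; have := r1; nra.
have /andP[h1 h2] : t%:R <= n%:R * p / 16 < t.+1%:R.
  by apply: truncn_itv; lra.
by split => //; rewrite -[t.+1%:R]natr1 in h2; lra.
Qed.

(** With [2 <= exp 1] and [1 - p / 2 <= exp (- p / 2)] the exponent is at most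
    [n p / 8 - p (n - 1) / 2]. *)
Lemma degree_prob_bound :
  2 ^+ (2 * t) * (1 - p / 2) ^+ n.-1 <= expR (- (n%:R * p / 8)).
Proof.
have [tl tu] := t_bounds; have p2 : 0 <= 1 - p / 2 by have := p1; lra.
apply: (@le_trans _ _ (expR 1 ^+ (2 * t) * expR (- (p / 2)) ^+ n.-1)).
  apply: ler_pM; rewrite ?exprn_ge0 //.
    apply: lerXn2r; rewrite ?nnegrE ?expR_ge0 //.
    by apply: le_trans (expR_ge1Dx 1); lra.
  apply: lerXn2r; rewrite ?nnegrE ?expR_ge0 //.
  by apply: le_trans (expR_ge1Dx _).
rewrite -!expRM_natl -expRD ler_expR natrM.
have -> : n.-1%:R = n%:R - 1 :> R.
  by rewrite -subn1 natrB // lt0n -(eqr_nat R) gt_eqF //; have := n84; lra.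
by have := n84; have := p0; nra.
Qed.

(** The weight [n + 20] collects the degree failures: [n] for round four and, through Markov's
    inequality, 20 for round two. *)
Lemma degree_tail_small : (n%:R + 20) * expR (- (n%:R * p / 8)) <= eps / 4.
Proof.
rewrite expRN ler_pdivrMr ?expR_gt0 //.
have x0 : 0 <= n%:R * p / 8 by rewrite np; have := pr; have := r0; nra.
(* The fourth-order term suffices: [x = n p / 8 >= 3 r] gives [x ^ 4 / 24 >= 81 n ^ 2 / 24]. *)
have := expR_ge1Dxn 3 x0; set e := expR _; rewrite -[(4`!)%N]/24%N => h.
have xr : 3 * r <= n%:R * p / 8 by rewrite np; have := pr; have := r0; nra.
have x4 : (3 * r) ^+ 4 <= (n%:R * p / 8) ^+ 4.
  by rewrite ler_pXn2r ?nnegrE // mulr_ge0 // ltW.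
have e4 : (3 * r) ^+ 4 = 81 * (n%:R * n%:R) by rewrite -rr; ring.
have ne : n%:R * n%:R <= e by rewrite e4 in x4; have := n84; nra.
case/andP: eps01 => e0 e1; have n84' := n84; have nb := n_big.
apply: (@le_trans _ _ (eps / 4 * (n%:R * n%:R))); last by rewrite ler_pM2l //; lra.
have : 84 * n%:R <= n%:R * eps * n%:R by rewrite ler_pM2r //; lra.
by lra.
Qed.

(** Since [4 <= exp 3] and [p * t >= (p * r) ^ 2 / 32 >= 100], the exponent is at most
    [3 n - 20 n]. *)
Lemma unbalanced_tail_small : 4 ^+ n * expR (- (p * t%:R * n%:R / 5)) <= eps / 4.
Proof.
have [tl tu] := t_bounds.
have h : 4 ^+ n <= expR (3 * n%:R) :> R.
  rewrite expRM_natr; apply: lerXn2r; rewrite ?nnegrE ?expR_ge0 //.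
  by apply: le_trans (expR_ge1Dx _); lra.
apply: (@le_trans _ _ (expR (- n%:R))).
  apply: (@le_trans _ _ (expR (3 * n%:R) * expR (- (p * t%:R * n%:R / 5)))).
    by rewrite ler_wpM2r ?expR_ge0.
  rewrite -expRD ler_expR.
  have pt : 100 <= p * t%:R.
    have : p * (n%:R * p / 32) <= p * t%:R by rewrite ler_pM2l.
    have -> : p * (n%:R * p / 32) = (p * r) * (p * r) / 32 by rewrite -rr; ring.
    by have := pr; nra.
  have : 100 * n%:R <= p * t%:R * n%:R by apply: ler_wpM2r.
  by have := n84; lra.
rewrite expRN; apply: (@le_trans _ _ (n%:R)^-1).
  rewrite lef_pV2 ?posrE ?expR_gt0 //; last by have := n84; lra.
  by apply: le_trans (expR_ge1Dx _); lra.
rewrite -[_^-1]mul1r ler_pdivrMr; last by have := n84; lra.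
by have := n_big; lra.
Qed.

Variable s : {ffun 'I_n -> bool}.
Hypothesis magn_big : delta * r <= (magn s)%:~R.

(** The window has width of order [r * sqrt p] and the blocks have length of order at least
    [delta * p * r], so their number is of order at most [1 / (delta * sqrt p)]. *)
Lemma hvote_mean_lower u v : u != v ->
  delta * Num.sqrt p / 400 <= Ex p (away v) (hvote R s u).
Proof.
move=> uv; have mex := magn_except s uv.
set A := #|_| in mex; set B := #|_| in mex.
have mexR : (magn s)%:~R - 2 <= A%:R - B%:R :> R.
  by move: mex; rewrite -(ler_int R) !rmorphB.
have magn_b := magn_big; have rb := r_big.
have BA : (B <= A)%N by rewrite -(ler_nat R); lra.
(* The surplus of +1 over -1 without [u] and [v]; [4 <= delta * r] absorbs the loss of 2. *)
pose d := (A - B)%N.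
have dE : d%:R = A%:R - B%:R :> R by rewrite natrB.
have d_low : delta * r / 2 <= d%:R by rewrite dE; lra.
have BE : (B + d)%N = A by rewrite subnKC.
set mu := d%:R * p; have mu_low : p * r * delta / 2 <= mu.
  have : p * (delta * r / 2) <= p * d%:R by rewrite ler_pM2l.
  by rewrite /mu; lra.
have mu_big : 50 <= mu by have := prd; lra.
pose l := Num.truncn (mu / 2).
have /andP[l1 l2] : l%:R <= mu / 2 < l.+1%:R by apply: truncn_itv; lra.
have l3 : (2 < l)%N by rewrite -(ltr_nat R); rewrite -[l.+1%:R]natr1 in l2; lra.
pose sp := Num.sqrt p; have sp0 : 0 < sp by rewrite sqrtr_gt0.
have spp : sp ^+ 2 = p by rewrite sqr_sqrtr // ltW.
have sp1 : sp <= 1.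
  by rewrite -(@ler_pXn2r _ 2) ?nnegrE ?(ltW sp0) // spp expr1n.
have rsp1 : 1 <= r * sp.
  by rewrite -(@ler_pXn2r _ 2) ?nnegrE ?mulr_ge0 ?(ltW sp0) ?(ltW r0) // exprMn spp rr expr1n np; have := pr; have := r1; nra.
pose w := (Num.truncn (2 * (r * sp))).+1.
have /andP[w1 w2] : (Num.truncn (2 * (r * sp)))%:R <= 2 * (r * sp) < w%:R.
  by apply: truncn_itv; lra.
have w3 : w%:R <= 3 * (r * sp) by rewrite /w -[leLHS]natr1; lra.
have Bn : B%:R <= n%:R :> R by rewrite ler_nat -[leqRHS]card_ord max_card.
have bw : 2 * (B%:R * p) <= w%:R ^+ 2.
  apply: (@le_trans _ _ ((2 * (r * sp)) ^+ 2)); last first.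
    by rewrite ler_pXn2r ?nnegrE // ?(ltW w2) // mulr_ge0 // mulr_ge0 // ltW.
  rewrite !exprMn spp rr.
  have : B%:R * p <= n%:R * p by rewrite ler_pM2r.
  have : 0 <= n%:R * p by rewrite mulr_ge0 // ltW.
  by lra.
have mean := @hvote_mean R p n s p01 u v B d l w uv (erefl _) BE l3 (ltn0Sn _).
apply: le_trans (mean _ _ bw); rewrite -/mu; [|lra|lra].
rewrite -[leLHS]invrK lef_pV2 ?posrE ?invr_gt0 ?divr_gt0 ?mulr_gt0 ?ltr0n //; last first.
  by case/andP: delta01.
case/andP: delta01 => dl0 dl1.
have -> : (delta * sp / 400)^-1 = 400 / (delta * sp).
  by field; rewrite !gt_eqF.
have dsp0 : 0 < delta * sp by rewrite mulr_gt0.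
have dsp1 : delta * sp <= 1 by rewrite mulr_ile1 // ltW.
rewrite ler_pdivlMr //.
set q := (_ %/ _)%N; rewrite -[q.+1%:R]natr1; have qle : q%:R * (mu / 4) <= 6 * (r * sp).
  have : (q * l.-1 <= 2 * w)%N by apply: leq_divM.
  rewrite -(ler_nat R) !natrM -subn1 natrB ?(ltn_trans _ l3) // => h.
  have : q%:R * (mu / 4) <= q%:R * (l%:R - 1).
    by apply: ler_wpM2l => //; rewrite -[l.+1%:R]natr1 in l2; lra.
  by lra.
(* Together with [delta * sp <= 1] this gives [8 * (48 + 1) <= 400], the source of the constant
   400. *)
have : q%:R * (delta * sp) <= 48.
  rewrite -(@ler_pM2r _ (r * sp)); last by lra.
  have -> : q%:R * (delta * sp) * (r * sp) = q%:R * (p * r * delta).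
    by rewrite -spp; ring.
  have : q%:R * (p * r * delta / 2) <= q%:R * mu by apply: ler_wpM2l.
  by lra.
by lra.
Qed.

(** Three errors of [eps / 4]: degree failures, imbalance, and 20 times the Chebyshev term
    [eps / 80] of round two. *)
Lemma prob_good_state :
  Ex p (pairs n) (fun E => (~~ [forall v, maj_iter E 4 s v])%:R) <= 3 / 4 * eps.
Proof.
have [tl tu] := t_bounds; case/andP: delta01 => dl0 dl1; case/andP: eps01 => e0 e1.
have npb : 200 * 200 <= n%:R * p by rewrite np; have := pr; have := r1; nra.
have t0 : (0 < t)%N by rewrite -(ltr_nat R); lra.
have t0R : 0 < t%:R :> R by rewrite ltr0n.
set kap := delta * Num.sqrt p / 400.
have kap0 : 0 < kap by rewrite divr_gt0 // mulr_gt0 // sqrtr_gt0.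
have deg v : Ex p (pairs n) (fun E => (#|nbrs E v| < 2 * t)%N%:R) <=
    expR (- (n%:R * p / 8)).
  exact: le_trans (prob_small_degree p01 _ _) degree_prob_bound.
(* [kap ^ 2 * 2 t] is at least [(p r delta) ^ 2 / (400 ^ 2 * 16)]; by [lam_p], [eps] times this is
   at least 625, where 160 is needed. *)
have kap2 : 2 / (kap ^+ 2 * (2 * t)%N%:R) <= eps / 80.
  rewrite ler_pdivrMr; last by rewrite mulr_gt0 ?exprn_gt0 // ltr0n muln_gt0.
  have -> : kap ^+ 2 = delta ^+ 2 * p / (400 * 400).
    rewrite /kap !exprMn sqr_sqrtr ?(ltW p0) //.
    by field.
  have : delta ^+ 2 * p / (400 * 400) * (n%:R * p / 16) <=
      delta ^+ 2 * p / (400 * 400) * (2 * t)%N%:R.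
    rewrite ler_pM2l ?divr_gt0 ?mulr_gt0 ?exprn_gt0 // natrM; lra.
  have -> : delta ^+ 2 * p / (400 * 400) * (n%:R * p / 16) =
     (p * r * delta) ^+ 2 / (400 * 400 * 16) by rewrite -rr; field.
  have prde : 200 * 200 <= p * r * delta * eps by have := lam_p; lra.
  have : 200 * 200 * (200 * 200) <= eps * (p * r * delta) ^+ 2.
    apply: (@le_trans _ _ ((p * r * delta * eps) * (p * r * delta))).
      by apply: ler_pM; rewrite ?prd ?mulr_ge0.
    by rewrite le_eqVlt; apply/orP; left; apply/eqP; ring.
  move: ((p * r * delta) ^+ 2) (delta ^+ 2 * p / (400 * 400) * _) => X Y h1 h2.
  have : eps * (X / (400 * 400 * 16)) <= eps * Y by apply: ler_wpM2l => //; lra.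
  by lra.
have eta v : Ex p (pairs n) (fun E => (~~ maj_iter E 2 s v)%:R) <=
    expR (- (n%:R * p / 8)) + eps / 80.
  have := @prob_second_round R p n s p01 v (2 * t) kap.
  rewrite muln_gt0 /= t0 => /(_ isT kap0) h; apply: le_trans (h _) _.
    by move=> u uv; apply: hvote_mean_lower.
  exact: lerD.
have n7 : (7 <= n)%N by rewrite -(ler_nat R); have := n84; lra.
apply: le_trans (prob_fourth_round p01 n7 t0 deg eta) _.
have := degree_tail_small; have := unbalanced_tail_small; lra.
Qed.

End GoodState.

(** * Averaging over the initial state *)

Lemma prob_agree4E (R : realType) n (p : R) : prob_agree4 n p =
  \sum_(s : {ffun 'I_n -> bool})
    Ex p (pairs n) (fun E => (all_agree4 E s)%:R) / 2 ^+ n.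
Proof.
rewrite /prob_agree4; under [RHS]eq_bigr do rewrite /Ex mulr_suml.
rewrite exchange_big /=; apply: eq_bigr => E _.
rewrite big_mkcond; apply: eq_bigr => s _.
by case: (all_agree4 E s); rewrite ?mulr1 ?mulr0 ?mul0r.
Qed.

Theorem theorem1p1 (R : realType) (eps : R) :
  0 < eps <= 1 ->
  exists lam : R, 0 < lam /\
  exists n0 : nat, forall n : nat, (n0 < n)%N ->
  forall p : R, lam / Num.sqrt (n%:R) <= p -> p <= 1 ->
  1 - eps <= prob_agree4 n p.
Proof.
move=> eps01; case/andP: (eps01) => e0 e1.
(* Nearly balanced initial states cost at most [delta + 2 / r <= eps / 8 + eps / 16], within the
   quarter of [eps] left by [prob_good_state]. *)
pose delta := eps / 8; have delta01 : 0 < delta <= 1 by rewrite /delta; lra.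
have de0 : 0 < delta * eps by rewrite mulr_gt0 //; case/andP: delta01.
exists (200 * 200 / (delta * eps)); split; first by rewrite divr_gt0 // mulr_gt0.
(* [n * eps ^ 2 > 1024] gives [eps * r >= 32], hence [delta * r >= 4] and [2 / r <= eps / 16]. *)
exists (Num.truncn (1024 / eps ^+ 2)) => n n_gt p lam_p p1.
have e20 : 0 < eps ^+ 2 by rewrite exprn_gt0.
have n_big : 1024 < n%:R * eps ^+ 2.
  rewrite -ltr_pdivrMr //.
  have /andP[_ h] : (Num.truncn (1024 / eps ^+ 2))%:R <= 1024 / eps ^+ 2
      < (Num.truncn (1024 / eps ^+ 2)).+1%:R.
    by apply: truncn_itv; rewrite divr_ge0 // ltW.
  by apply: lt_le_trans h _; rewrite ler_nat.
have n0 : (0 < n)%N by apply: leq_ltn_trans n_gt.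
set r := Num.sqrt n%:R in lam_p.
have r0 : 0 < r by rewrite sqrtr_gt0 ltr0n.
have rr : r ^+ 2 = n%:R by rewrite sqr_sqrtr.
have r_big : 32 <= eps * r.
  rewrite -(@ler_pXn2r _ 2) ?nnegrE ?mulr_ge0 ?(ltW e0) ?(ltW r0) //.
  by rewrite exprMn rr; lra.
have pr : 200 * 200 <= p * r * (delta * eps).
  by move: lam_p; rewrite ler_pdivrMr // ler_pdivrMr.
have ne : 84 <= n%:R * eps.
  have : n%:R * eps ^+ 2 <= n%:R * eps.
    by apply: ler_wpM2l => //; rewrite expr2; nra.
  by lra.
have dr : 4 <= delta * r by rewrite /delta; lra.
have pos (s : {ffun 'I_n -> bool}) : delta * r <= (magn s)%:~R ->
    1 - 3 / 4 * eps <= Ex p (pairs n) (fun E => (all_agree4 E s)%:R).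
  move=> ms; have m0 : 0 < magn s by rewrite -(ltr0z R); lra.
  have := prob_good_state eps01 delta01 p1 dr ne pr ms.
  rewrite (@eq_Ex _ _ _ _ _ (fun E => 1 - (all_agree4 E s)%:R)) => [|E _].
    by rewrite ExB Ex_cst; lra.
  rewrite all_agree4_pos //; case: [forall v, _]; rewrite /= ?subrr ?subr0 //.
have p01 : 0 <= p <= 1.
  rewrite p1 andbT; apply: le_trans lam_p.
  by rewrite !divr_ge0 ?(ltW r0) ?(ltW de0) ?mulr_ge0.
pose bal0 (s : {ffun 'I_n -> bool}) := `|(magn s)%:~R| < delta * r.
have all_s (s : {ffun 'I_n -> bool}) : 1 - 3 / 4 * eps - (bal0 s)%:R <=
    Ex p (pairs n) (fun E => (all_agree4 E s)%:R).
  rewrite /bal0; case: ltrP => [_|ge].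
    apply: (@le_trans _ _ 0); first by rewrite /=; lra.
    by apply: Ex_ge0.
  rewrite /= subr0; move: ge; rewrite ler_normr => /orP[/pos //|ge].
  (* A large negative sum becomes a large positive one when the two states are exchanged. *)
  rewrite (@eq_Ex _ _ _ _ _ (fun E => (all_agree4 E (flip s))%:R)).
    by apply: pos; rewrite magn_flip rmorphN.
  by move=> E _; rewrite all_agree4_flip.
rewrite prob_agree4E; have p2 : 0 < 2 ^+ n :> R by rewrite exprn_gt0.
apply: (@le_trans _ _ (\sum_(s : {ffun 'I_n -> bool})
   (1 - 3 / 4 * eps - (bal0 s)%:R) / 2 ^+ n)); last first.
  by apply: ler_sum => s _; rewrite ler_pM2r ?invr_gt0.
have d0 : 0 <= delta by case/andP: delta01 => /ltW.
rewrite (eq_bigr (fun s => (1 - 3 / 4 * eps) / 2 ^+ n - (bal0 s)%:R / 2 ^+ n)).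
  rewrite sumrB sumr_const card_ffun card_bool card_ord.
  rewrite -[_ / _ *+ _]mulr_natr natrX.
  rewrite divfK ?gt_eqF //.
  have := balanced_spins_bound d0 n0; rewrite -/r.
  have : 2 / r <= eps / 16 by rewrite ler_pdivrMr //; lra.
  by rewrite /bal0 /delta; lra.
by move=> s _; rewrite mulrBl.
Qed.
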